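(* Let $M=(M_k)$ be a weight sequence and let $C^{[M]}$ denote either $C^{(M)}$ or $C^{\{M\}}$. Let $E,F,G$ be convenient vector spaces and let $U\subseteq F$ be $c^\infty$-open. A linear mapping $T:E\to C^{[M]}(U,G)$ is bounded (i.e. maps bounded sets to bounded sets) if and only if $\operatorname{ev}_x\circ T:E\to G$ is bounded for every $x\in U$, where $\operatorname{ev}_x(f)=f(x)$.
   Context: $\mathbb N=\{0,1,2,\dots\}$. A weight sequence $M=(M_k)_{k\in\mathbb N}$ is a sequence of positive reals with $M_0=1\le M_1$. $C^{[M]}$ stands, within one statement, either everywhere for $C^{(M)}$ or everywhere for $C^{\{M\}}$. Jets on Banach spaces. For Banach spaces $E,F$ let $L^k_{\rm sym}(E,F)$ be the Banach space of bounded symmetric $k$-linear maps $E^k\to F$ with the operator norm. For compact $K\subseteq E$ and $f=(f^k)_k\in\prod_k C(K,L^k_{\rm sym}(E,F))$ put $\|f\|_k=\sup_{x\in K}\|f^k(x)\|$, $(R^n_yf)^k(x)=f^k(x)-\sum_{j=0}^n\frac1{j!}f^{j+k}(y)(x-y,\dots,x-y,\cdot)$, $|||f|||_{n,k}=\sup\{(n+1)!\,\|(R^n_yf)^k(x)\|/\|x-y\|^{n+1}:x\ne y\in K\}$, and $$\|f\|_\rho=\max\Big\{\sup_m\frac{\|f\|_m}{m!\rho^mM_m},\ \sup_{n,k}\frac{|||f|||_{n,k}}{(n+k+1)!\rho^{n+k+1}M_{n+k+1}}\Big\}.$$ $C^M_\rho(E\supseteq K,F)$ is the space of those $f$ with $\|f\|_\rho<\infty$,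 normed by $\|\cdot\|_\rho$. For compact convex $K$ put $C^{(M)}(E\supseteq K,F)=\varprojlim_{\rho>0}C^M_\rho(E\supseteq K,F)$ and $C^{\{M\}}(E\supseteq K,F)=\varinjlim_{\rho>0}C^M_\rho(E\supseteq K,F)$ (locally convex limits). For open $U\subseteq E$, $C^{[M]}(U,F)$ is the space of all $C^\infty$ (Fréchet) maps $f:U\to F$ with $j^\infty f|_K=(f^{(k)}|_K)_k\in C^{[M]}(E\supseteq K,F)$ for all compact convex $K\subseteq U$, with the initial locally convex topology induced by the maps $f\mapsto j^\infty f|_K$. Convenient vector spaces. A convenient vector space is a real Hausdorff locally convex space that is Mackey complete. Its $c^\infty$-topology is the final topology with respect to all $C^\infty$-curves $\mathbb R\to E$. A mapping on a $c^\infty$-open set is $C^\infty$ if it maps $C^\infty$-curves to $C^\infty$-curves. $F^*$ is the space of continuous linear functionals. For closed absolutely convex bounded $B\subseteq E$, $E_B$ is the span of $B$ with the Minkowski functional of $B$ as norm (a Banach space), $i_B:E_B\to E$ the inclusion, $U_B=U\cap E_B$. For $c^\infty$-open $U\subseteq E$, $$C^{[M]}(U,F)=\{f\in C^\infty(U,F):\ell\circ f\circ i_B\in C^{[M]}(U_B,\mathbb R)\ \forall\ell\in F^*,\forall B\},$$ with the initial locally convex structure induced by all maps $f\mapsto\ell\circ f\circ i_B\in C^{[M]}(U_B,\mathbb R)$; this is a convenient vector space. *)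

(* Defs.v *)
From HB Require Import structures.
From mathcomp Require Import all_boot all_order all_algebra all_fingroup.
From mathcomp Require Import all_classical all_reals all_analysis.

Set Implicit Arguments.
Unset Strict Implicit.
Unset Printing Implicit Defensive.

Import Order.TTheory GRing.Theory Num.Theory.
Import numFieldNormedType.Exports.

Local Open Scope classical_set_scope.
Local Open Scope ring_scope.

Definition upd (T : Type) k (v : 'I_k -> T) (i : 'I_k) (x : T) : 'I_k -> T :=
  fun j => if j == i then x else v j.

(* The argument tuple (h, ..., h, v_0, ..., v_(k-1)) with h repeated j times. *)
Definition padl (T : Type) j k (h : T) (v : 'I_k -> T) : 'I_(j + k) -> T :=
  fun i => match fintype.split i with inl _ => h | inr i' => v i' end.
Arguments padl {T} j {k} h v _.

Section lsym.
Context {R : realType} {E F : normedModType R} {k : nat}.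
Implicit Types L : ('I_k -> E) -> F.

Definition multilinear L := forall (v : 'I_k -> E) i a x y,
  L (upd v i (a *: x + y)) = a *: L (upd v i x) + L (upd v i y).

Definition symmetric_map L :=
  forall (s : {perm 'I_k}) v, L (fun i => v (s i)) = L v.

Definition bounded_multi L :=
  exists C : R, forall v, `|L v| <= C * \prod_i `|v i|.

Definition lsym_pred : {pred ('I_k -> E) -> F} := fun L =>
  `[< [/\ multilinear L, symmetric_map L & bounded_multi L] >].

Definition opnorm L : R :=
  sup [set `|L v| | v in [set v | forall i, `|v i| <= 1]].

Lemma lsym_submod_closed : submod_closed lsym_pred.
Proof.
split=> [|a L1 L2].
  apply/asboolP; split=> [v i a x y|s v|] /=.
  - by rewrite /= scaler0 addr0.
  - by [].
  - by exists 0 => v; rewrite normr0 mul0r.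
move=> /asboolP[m1 s1 [C1 b1]] /asboolP[m2 s2 [C2 b2]]; apply/asboolP; split.
- move=> v i b x y; rewrite -![(_ + _) _]/(a *: L1 _ + L2 _).
  by rewrite m1 m2 !scalerDr !scalerA [a * b]mulrC addrACA.
- by move=> s v; rewrite -![(_ + _) _]/(a *: L1 _ + L2 _) s1 s2.
- exists (`|a| * C1 + C2) => v; rewrite -![(_ + _) _]/(a *: L1 _ + L2 _).
  rewrite (le_trans (ler_normD _ _))// mulrDl lerD// normrZ -mulrA.
  by rewrite ler_wpM2l.
Qed.

HB.instance Definition _ :=
  GRing.isSubmodClosed.Build R (('I_k -> E) -> F) lsym_pred lsym_submod_closed.

End lsym.

Record Lsym (R : realType) (k : nat) (E F : normedModType R) := MkLsym {
  lsym_fun :> ('I_k -> E) -> F ;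
  lsymP : lsym_fun \in lsym_pred }.

Section lsym_normed.
Context {R : realType} {k : nat} {E F : normedModType R}.
Local Notation L := (Lsym k E F).

HB.instance Definition _ := [isSub for @lsym_fun R k E F].
HB.instance Definition _ := [Choice of L by <:].
HB.instance Definition _ := [SubChoice_isSubLmodule of L by <:].

Lemma lsym_scale (l : L) (c : 'I_k -> R) (v : 'I_k -> E) :
  l (fun i => c i *: v i) = (\prod_i c i) *: l v.
Proof.
have /asboolP[ml _ _] := lsymP l.
have scale1 w i a x : l (upd w i (a *: x)) = a *: l (upd w i x).
  have l0 : l (upd w i 0) = 0.
    have := ml w i 1 0 0; rewrite scale1r scale1r addr0.
    by move/eqP; rewrite -subr_eq0 opprD addrA subrr sub0r oppr_eq0 => /eqP.
  by have := ml w i a x 0; rewrite l0 !addr0.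
have key s : uniq s -> l (fun i => if i \in s then c i *: v i else v i) =
    (\prod_(i <- s) c i) *: l v.
  elim: s => [_|i s IH /= /andP[ins us]].
    by rewrite big_nil scale1r.
  rewrite big_cons -scalerA -IH//.
  pose w j := if j \in s then c j *: v j else v j.
  have -> : (fun j => if j \in i :: s then c j *: v j else v j) =
            upd w i (c i *: v i).
    by apply/funext => j; rewrite /upd /w inE; case: eqVneq => [->|].
  rewrite scale1; congr (_ *: l _); apply/funext => j; rewrite /upd /w.
  by case: eqVneq => [->|//]; rewrite (negbTE ins).
rewrite -big_enum -key ?enum_uniq//; congr (l _).
by apply/funext => i; rewrite mem_enum.
Qed.

Lemma opnorm_has_sup (l : L) :
  has_sup [set `|l v| | v in [set v | forall i, `|v i| <= 1]].
Proof.
split; first by exists `|l (fun=> 0)|, (fun=> 0) => //= i; rewrite normr0.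
have /asboolP[_ _ [C bl]] := lsymP l.
exists `|C| => _ [v v1 <-]; rewrite (le_trans (bl v))//.
rewrite (le_trans (ler_norm _))// normrM -[leRHS]mulr1 ler_wpM2l//.
rewrite ger0_norm ?prodr_ge0//; apply: prodr_ile1 => i _.
by rewrite normr_ge0 v1.
Qed.

Lemma opnorm_ub (l : L) v : (forall i, `|v i| <= 1) -> `|l v| <= opnorm l.
Proof. by move=> v1; apply: ub_le_sup; [exact: (opnorm_has_sup l).2|exists v]. Qed.

Lemma opnorm_ge0 (l : L) : 0 <= opnorm l.
Proof.
by rewrite (le_trans (normr_ge0 (l (fun=> 0))))// opnorm_ub// => i; rewrite normr0.
Qed.

Lemma opnormP (l : L) v : `|l v| <= opnorm l * \prod_i `|v i|.
Proof.
have := @opnorm_ub l (fun i => `|v i|^-1 *: v i) => /= H.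
have -> : v = fun i => `|v i| *: (`|v i|^-1 *: v i).
  apply/funext => i; have [->|vi0] := eqVneq (v i) 0; first by rewrite !scaler0.
  by rewrite scalerA divff ?normr_eq0// scale1r.
rewrite (lsym_scale _ (fun i => `|v i|)) normrZ mulrC.
rewrite normr_prod.
have -> : \prod_i `| `|v i| | = \prod_i `| `|v i| *: (`|v i|^-1 *: v i)|.
  apply: eq_bigr => i _; have [->|vi0] := eqVneq (v i) 0.
    by rewrite !scaler0 !normr0.
  by rewrite scalerA divff ?normr_eq0// scale1r normr_id.
rewrite ler_wpM2r ?prodr_ge0// H// => i; rewrite normrZ normfV normr_id.
have [->|vi0] := eqVneq (v i) 0; first by rewrite normr0 mulr0.
by rewrite mulVf ?normr_eq0.
Qed.

Let ler_opnormD (l1 l2 : L) : opnorm (l1 + l2 : L) <= opnorm l1 + opnorm l2.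
Proof.
apply: sup_le_ub; first exact: (opnorm_has_sup (l1 + l2)).1.
by move=> _ [v v1 <-]; rewrite (le_trans (ler_normD _ _)) ?lerD ?opnorm_ub.
Qed.

Let opnormZ (a : R) (l : L) : opnorm (a *: l : L) = `|a| * opnorm l.
Proof.
have le b (m : L) : opnorm (b *: m : L) <= `|b| * opnorm m.
  apply: sup_le_ub; first exact: (opnorm_has_sup (b *: m)).1.
  move=> _ [v v1 <-]; rewrite -[(lsym_fun _) v]/(b *: m v) normrZ.
  by rewrite ler_wpM2l// opnorm_ub.
apply/eqP; rewrite eq_le le andTb; have [->|a0] := eqVneq a 0.
  by rewrite normr0 mul0r; exact: opnorm_ge0.
have := le a^-1 (a *: l); rewrite scalerA mulVf// scale1r normfV.
by rewrite ler_pdivlMl ?normr_gt0.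
Qed.

Let opnorm_eq0 (l : L) : opnorm l = 0 -> l = 0.
Proof.
move=> l0; apply/val_inj/funext => v /=; apply/eqP; rewrite -normr_le0.
by rewrite (le_trans (opnormP l v))// l0 mul0r.
Qed.

HB.instance Definition _ := @Lmodule_isNormed.Build R L
  (fun l : L => opnorm l) ler_opnormD opnormZ opnorm_eq0.

End lsym_normed.

Section lsym_plug.
Context {R : realType} {E F : normedModType R} (j k : nat).

Lemma lsym_plug_subproof (l : Lsym (j + k) E F) (h : E) :
  (fun v : 'I_k -> E => l (padl j h v)) \in lsym_pred.
Proof.
have /asboolP[ml sl _] := lsymP l; apply/asboolP; split.
- have H v i x : padl j h (upd v i x) = upd (padl j h v) (rshift j i) x.
    apply/funext => a; rewrite /padl /upd; case: (split_ordP a) => b ->.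
      by rewrite eq_lrshift.
    by rewrite (inj_eq (@rshift_inj _ _)).
  by move=> v i a x y; rewrite !H ml.
- move=> s v.
  pose g (a : 'I_(j + k)) := match fintype.split a with
    inl b => lshift k b | inr b => rshift j (s b) end.
  have injg : injective g.
    move=> a b; rewrite /g; case: (split_ordP a) => c ->; case: (split_ordP b) => d ->.
    - by move/lshift_inj ->.
    - by move/eqP; rewrite eq_lrshift.
    - by move/eqP; rewrite eq_rlshift.
    - by move/rshift_inj/perm_inj ->.
  rewrite -(sl (perm injg) (padl j h v)); congr (l _).
  apply/funext => a; rewrite permE /padl /g; case: (split_ordP a) => c _.
    by case: (split_ordP (lshift k c)) => d /eqP; rewrite ?eq_lrshift.
  case: (split_ordP (rshift j (s c))) => d /eqP; rewrite ?eq_rlshift//.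
  by rewrite eq_rshift => /eqP ->.
- exists (opnorm l * `|h| ^+ j) => v; rewrite (le_trans (opnormP _ _))//.
  rewrite big_split_ord/= -mulrA ler_wpM2l ?opnorm_ge0//.
  rewrite le_eqVlt; apply/orP; left; apply/eqP; congr (_ * _).
    under eq_bigr do rewrite /padl (unsplitK (inl _)).
    by rewrite prodr_const card_ord.
  by apply: eq_bigr => i _; rewrite /padl (unsplitK (inr _)).
Qed.

Definition lsym_plug (l : Lsym (j + k) E F) (h : E) : Lsym k E F :=
  MkLsym (lsym_plug_subproof l h).

End lsym_plug.
Arguments lsym_plug {R E F} j {k} l h.

Definition absconvex (R : realType) (V : lmodType R) (A : set V) :=
  A !=set0 /\ forall (a b : R) x y, `|a| + `|b| <= 1 -> A x -> A y ->
    A (a *: x + b *: y).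

(* A locally convex space whose underlying vector space is a subspace of V,
   given by this subspace and by its neighbourhoods of 0. Supersets in V of
   neighbourhoods of 0 are kept; only their trace on the carrier matters. *)
Record lcs (R : realType) (V : lmodType R) := Lcs {
  lcs_carrier : set V ;
  lcs_nbhs0 : set_system V }.

Definition lcs_of_tvs (R : realType) (V : tvsType R) : lcs V :=
  Lcs setT (nbhs (0 : V)).

Definition lcs_bounded (R : realType) (V : lmodType R) (X : lcs V)
    (A : set V) :=
  A `<=` lcs_carrier X /\ forall N, lcs_nbhs0 X N ->
    exists2 r : R, 0 < r & A `<=` [set r *: x | x in N].

Definition bounded_map (R : realType) (V W : lmodType R) (X : lcs V)
    (Y : lcs W) (f : V -> W) :=
  forall A, lcs_bounded X A -> lcs_bounded Y (f @` A).

(* p is meant to be a norm on the vectors of S at which it is finite. *)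
Definition lcs_normed (R : realType) (V : lmodType R) (S : set V)
    (p : V -> \bar R) : lcs V :=
  let X := [set v | S v /\ (p v < +oo)%E] in
  Lcs X [set N | exists2 e : R, 0 < e & X `&` [set v | (p v < e%:E)%E] `<=` N].

Definition lcs_initial (R : realType) (V : lmodType R) (S : set V)
    (I : Type) (D : set I) (W : I -> lmodType R) (f : forall i, V -> W i)
    (X : forall i, lcs (W i)) : lcs V :=
  Lcs [set v | S v /\ forall i, D i -> lcs_carrier (X i) (f i v)]
      (smallest Filter
        (\bigcup_(i in D) [set f i @^-1` N | N in lcs_nbhs0 (X i)])).

(* Projective and inductive limits of subspaces of V ordered by inclusion;
   the latter is given the finest locally convex topology making all the
   inclusions continuous. *)
Definition lcs_projlim (R : realType) (V : lmodType R) (I : Type) (D : set I)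
    (X : I -> lcs V) : lcs V :=
  lcs_initial setT D (fun _ => id) X.

Definition lcs_indlim (R : realType) (V : lmodType R) (I : Type) (D : set I)
    (X : I -> lcs V) : lcs V :=
  let Y := \bigcup_(i in D) lcs_carrier (X i) in
  Lcs Y [set N | exists A, [/\ absconvex A, A `<=` Y,
    (forall i, D i -> lcs_nbhs0 (X i) A) & A `<=` N]].

Definition jet (R : realType) (E F : normedModType R) (X : Type) :=
  forall k : nat, X -> Lsym k E F.

Section jet_lmod.
Context {R : realType} {E F : normedModType R} {X : Type}.
Local Notation J := (jet E F X).
Implicit Types f g h : J.

HB.instance Definition _ := gen_eqMixin J.
HB.instance Definition _ := gen_choiceMixin J.

Let j0 : J := fun _ _ => 0.
Let jadd f g : J := fun k x => f k x + g k x.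
Let jopp f : J := fun k x => - f k x.
Let jscale (a : R) f : J := fun k x => a *: f k x.

Let jext f g : (forall k x, f k x = g k x) -> f = g.
Proof. by move=> fg; apply: functional_extensionality_dep => k; apply/funext. Qed.

Let jaddA : associative jadd.
Proof. by move=> f g h; apply: jext => k x; exact: addrA. Qed.
Let jaddC : commutative jadd.
Proof. by move=> f g; apply: jext => k x; exact: addrC. Qed.
Let jadd0 : left_id j0 jadd.
Proof. by move=> f; apply: jext => k x; exact: add0r. Qed.
Let jaddN : left_inverse j0 jopp jadd.
Proof. by move=> f; apply: jext => k x; exact: addNr. Qed.

HB.instance Definition _ := GRing.isZmodule.Build J jaddA jaddC jadd0 jaddN.

Let jscaleA a b f : jscale a (jscale b f) = jscale (a * b) f.
Proof. by apply: jext => k x; exact: scalerA. Qed.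
Let jscale1 : left_id 1 jscale.
Proof. by move=> f; apply: jext => k x; exact: scale1r. Qed.
Let jscaleDr : right_distributive jscale +%R.
Proof. by move=> a f g; apply: jext => k x; exact: scalerDr. Qed.
Let jscaleDl f : {morph jscale^~ f : a b / a + b}.
Proof. by move=> a b; apply: jext => k x; exact: scalerDl. Qed.

HB.instance Definition _ :=
  GRing.Zmodule_isLmodule.Build R J jscaleA jscale1 jscaleDr jscaleDl.

End jet_lmod.

Variant flavour := Beurling | Roumieu.

Definition weight_sequence (R : realType) (M : nat -> R) :=
  [/\ forall k, 0 < M k, M 0%N = 1 & 1 <= M 1%N].

(* Supremum in [0, +oo], with value 0 on the empty set. *)
Definition sup0 (R : realType) (A : set \bar R) : \bar R :=
  ereal_sup (0%E |` A).

Section jet_spaces.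
Context {R : realType} {E F : normedModType R} (M : nat -> R).

Section norms.
Variable K : set E.
Implicit Types (f : jet E F K) (n k m : nat) (x y : K).

Definition jnorm f m : \bar R := sup0 [set (`|f m x|)%:E | x in [set: K]].

Definition jrem f n k y x : Lsym k E F :=
  f k x - \sum_(j < n.+1) (j`!%:R)^-1 *: lsym_plug j (f (j + k)%N y)
                                           (val x - val y).

Definition jremnorm f n k : \bar R :=
  sup0 [set (n.+1`!%:R * `|jrem f n k xy.2 xy.1|
              / `|val xy.1 - val xy.2| ^+ n.+1)%:E
       | xy in [set xy : K * K | xy.1 <> xy.2]].

Definition jnorm_rho (rho : R) f : \bar R :=
  maxe (sup0 [set (jnorm f m * ((m`!%:R * rho ^+ m * M m)^-1)%:E)%E
             | m in [set: nat]])
       (sup0 [set (jremnorm f nk.1 nk.2 *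
                   (((nk.1 + nk.2).+1`!%N%:R * rho ^+ (nk.1 + nk.2).+1%N
                     * M (nk.1 + nk.2).+1%N)^-1)%:E)%E
             | nk in [set: nat * nat]]).

Definition CM_rho (rho : R) : lcs (jet E F K) :=
  lcs_normed [set f : jet E F K | forall k, continuous (f k)] (jnorm_rho rho).

Definition CM_compact (b : flavour) : lcs (jet E F K) :=
  match b with
  | Beurling => lcs_projlim [set rho : R | 0 < rho] CM_rho
  | Roumieu => lcs_indlim [set rho : R | 0 < rho] CM_rho
  end.

End norms.

Section open_sets.
Variable U : set E.

(* D k extends the k-th Frechet derivative of f to E; its values outside the
   open set U are irrelevant. *)
Definition frechet_derivs (f : U -> F) (D : jet E F E) :=
  (forall (x : U) v, D 0%N (val x) v = f x) /\
  (forall k x, U x -> is_diff x (D k) (fun h => lsym_plug 1 (D (1 + k)%N x) h)).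

Definition frechet_smooth (f : U -> F) := exists D, frechet_derivs f D.

Definition jinf (K : set E) (f : U -> F) : jet E F K :=
  fun k x => xget 0 (frechet_derivs f) k (val x).

Definition CM_open (b : flavour) : lcs (U -> F) :=
  lcs_initial frechet_smooth
    [set K : set E | [/\ compact K, convex_set K & K `<=` U]]
    jinf (fun K => CM_compact K b).

End open_sets.
End jet_spaces.

Section tvs_notions.
Context {R : realType} {E : tvsType R}.

Definition mackey_cauchy (x : nat -> E) := exists B : set E,
  [/\ lcs_bounded (lcs_of_tvs E) B, absconvex B &
   exists2 mu : nat * nat -> R, mu @ (filter_prod \oo \oo) --> (0 : R) &
     forall n m, [set mu (n, m) *: b | b in B] (x n - x m)].

Definition mackey_complete :=
  forall x : nat -> E, mackey_cauchy x ->
    exists l : E, x @ \oo --> l.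

Definition smooth_curve (c : R -> E) := exists2 d : nat -> R -> E, d 0%N = c &
  forall n t, h^-1 *: (d n (t + h) - d n t) @[h --> (0 : R)^'] --> d n.+1 t.

Definition cinfty_open (U : set E) :=
  forall c : R -> E, smooth_curve c -> open (c @^-1` U).

End tvs_notions.
Arguments mackey_complete {R} E.

HB.mixin Record Tvs_isConvenient (R : realType) E of Tvs R E := {
  convenient_hausdorff : hausdorff_space E ;
  convenient_complete : mackey_complete E }.

#[short(type="convenientType")]
HB.structure Definition Convenient (R : realType) :=
  {E of Tvs_isConvenient R E & Tvs R E}.

Definition smooth_map (R : realType) (F G : tvsType R) (U : set F)
    (f : U -> G) :=
  forall c : R -> U, smooth_curve (fun t => val (c t)) ->
    smooth_curve (fun t => f (c t)).

Definition lin_span (R : realType) (V : lmodType R) (B : set V) : set V :=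
  smallest (fun S : set V => submod_closed (fun x => x \in S)) B.

Definition minkowski (R : realType) (V : lmodType R) (B : set V) (x : V) : R :=
  inf [set r | 0 < r /\ [set r *: b | b in B] x].

(* E_B below is built for all such B; Hausdorffness makes the Minkowski
   functional of B definite, and Mackey completeness makes E_B complete. *)
Record bdisk (R : realType) (E : convenientType R) := MkBdisk {
  bdisk_set : set E ;
  bdisk_closed : closed bdisk_set ;
  bdisk_absconvex : absconvex bdisk_set ;
  bdisk_bounded : lcs_bounded (lcs_of_tvs E) bdisk_set }.

Section EB_pred.
Context {R : realType} {E : convenientType R} (B : bdisk E).

Definition EB_pred : {pred E} := fun x => x \in lin_span (bdisk_set B).

Lemma EB_submod_closed : submod_closed EB_pred.
Proof.
split=> [|a x y /set_mem xB /set_mem yB]; apply/mem_set => S [Sc BS].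
  by have [/set_mem] := Sc.
by have [_ Sl] := Sc; apply/set_mem/Sl; apply/mem_set; [exact: xB|exact: yB].
Qed.

HB.instance Definition _ :=
  GRing.isSubmodClosed.Build R E EB_pred EB_submod_closed.

End EB_pred.

Record EB (R : realType) (E : convenientType R) (B : bdisk E) := MkEB {
  EB_incl : E ;
  EB_inclP : EB_incl \in EB_pred B }.

Section EB_normed.
Context {R : realType} {E : convenientType R} (B : bdisk E).

HB.instance Definition _ := [isSub for @EB_incl R E B].
HB.instance Definition _ := [Choice of EB B by <:].
HB.instance Definition _ := [SubChoice_isSubLmodule of EB B by <:].

Local Notation D := (bdisk_set B).
Local Notation S x := [set r | 0 < r /\ [set r *: b | b in D] x].

Let D0 : D 0.
Proof.
have [[x Dx] /(_ 0 0 x x)] := bdisk_absconvex B.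
by rewrite !scale0r addr0 normr0 addr0; apply.
Qed.

Let Sadd x y r s : S x r -> S y s -> S (x + y) (r + s).
Proof.
move=> -[r0 [b Db <-]] [s0 [c Dc <-]]; have rs0 := addr_gt0 r0 s0.
split=> //; exists ((r / (r + s)) *: b + (s / (r + s)) *: c).
  have [_] := bdisk_absconvex B; apply=> //.
  by rewrite !gtr0_norm ?divr_gt0// -mulrDl divff// gt_eqF.
by rewrite scalerDr !scalerA !(mulrC (r + s)) !divfK// gt_eqF.
Qed.

Let Sscale a x r : a != 0 -> S x r -> S (a *: x) (`|a| * r).
Proof.
move=> a0 -[r0 [b Db <-]]; split; first by rewrite mulr_gt0 ?normr_gt0.
exists ((a / `|a|) *: b + 0 *: b).
  have [_] := bdisk_absconvex B; apply=> //.
  by rewrite normrM normfV normr_id divff ?normr_eq0// normr0 addr0.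
rewrite scale0r addr0 !scalerA; congr (_ *: _).
by rewrite mulrAC mulrCA divff ?normr_eq0// mulr1.
Qed.

Let S0 r : 0 < r -> S 0 r.
Proof. by move=> r0; split=> //; exists 0 => //; rewrite scaler0. Qed.

Let Sspan x : x \in EB_pred B -> S x !=set0.
Proof.
move=> /set_mem /(_ [set x | S x !=set0]); apply; split.
  split; first by apply/mem_set; exists 1; exact: S0.
  move=> a y z /set_mem[r Sr] /set_mem[s Ss]; apply/mem_set => /=.
  have [->|a0] := eqVneq a 0; first by exists s; rewrite scale0r add0r.
  by exists (`|a| * r + s); apply: Sadd => //; exact: Sscale.
by move=> y Dy; exists 1; split=> //; exists y => //; rewrite scale1r.
Qed.

Let Sinf x : x \in EB_pred B -> has_inf (S x).
Proof. by move=> /Sspan Sx; split=> //; exists 0 => r [/ltW]. Qed.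

Let mink_lb x r : S x r -> minkowski D x <= r.
Proof. by move=> Sr; apply: ge_inf => //; exists 0 => s [/ltW]. Qed.

Let mink_ge x m : x \in EB_pred B -> (forall r, S x r -> m <= r) ->
  m <= minkowski D x.
Proof. by move=> xB mS; apply: lb_le_inf => //; exact: Sspan. Qed.

Let mink0 : minkowski D 0 = 0.
Proof.
apply/eqP; rewrite eq_le; apply/andP; split; last first.
  by apply: mink_ge => [|r [/ltW]//]; exact: rpred0.
by apply/ler_addgt0Pl => e e0; rewrite addr0 mink_lb//; exact: S0.
Qed.

Let norm (x : EB B) := minkowski D (EB_incl x).

Let ler_normD (x y : EB B) : norm (x + y) <= norm x + norm y.
Proof.
rewrite -lerBlDr; apply: (@mink_ge (EB_incl x) _ (EB_inclP x)) => r Sr.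
rewrite lerBlDr -lerBlDl.
apply: (@mink_ge (EB_incl y) _ (EB_inclP y)) => s Ss.
by rewrite lerBlDl; apply: mink_lb; exact: Sadd.
Qed.

Let normZ (a : R) (x : EB B) : norm (a *: x) = `|a| * norm x.
Proof.
have [->|a0] := eqVneq a 0.
  by rewrite scale0r normr0 mul0r; exact: mink0.
have le b (y : EB B) : b != 0 -> norm (b *: y) <= `|b| * norm y.
  move=> b0; rewrite -ler_pdivrMl ?normr_gt0//.
  apply: (@mink_ge (EB_incl y) _ (EB_inclP y)) => r Sr.
  rewrite ler_pdivrMl ?normr_gt0//; apply: mink_lb; exact: Sscale.
apply/eqP; rewrite eq_le le// andTb.
have := le a^-1 (a *: x); rewrite invr_eq0 => /(_ a0).
by rewrite scalerA mulVf// scale1r normfV ler_pdivlMl ?normr_gt0.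
Qed.

Let norm_eq0 (x : EB B) : norm x = 0 -> x = 0.
Proof.
move=> x0; apply/val_inj/(@convenient_hausdorff R E) => /= N P Nx P0.
exists (EB_incl x); split; first exact: nbhs_singleton.
have := @scale_continuous R E (0, 0) P; rewrite /= scale0r => /(_ P0).
move=> [[V W]/= [/nbhs_ballP[e /= e0 eV] W0] VWP].
have [_ /(_ W W0)[t t0 DW]] := bdisk_bounded B.
have : exists2 r, S (EB_incl x) r & r < e / t.
  apply/not_exists2P => H.
  have : e / t <= norm x.
    apply: (@mink_ge (EB_incl x) _ (EB_inclP x)) => r Sr.
    by case: (H r) => // /negP; rewrite -leNgt.
  by rewrite x0 leNgt divr_gt0.
move=> [r [r0 [b Db <-]] ret].
have [w Ww <-] := DW b Db.
rewrite scalerA; apply: (VWP (r * t, w)); split=> //=.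
apply: eV; rewrite /ball/= sub0r normrN gtr0_norm ?mulr_gt0//.
by rewrite -ltr_pdivlMr.
Qed.

HB.instance Definition _ := @Lmodule_isNormed.Build R (EB B)
  norm ler_normD normZ norm_eq0.

End EB_normed.

Section CM.
Context {R : realType} {F G : convenientType R} (M : nat -> R) (b : flavour).
Variable U : set F.

Definition trace (B : bdisk F) : set (EB B) := [set x | U (EB_incl x)].
Arguments trace B : clear implicits.

Definition trace_incl (B : bdisk F) (x : trace B) : U :=
  exist _ (EB_incl (val x)) (mem_set (set_mem (valP x) : U _)).

Definition CM : lcs (U -> G) :=
  lcs_initial (@smooth_map R F G U)
    [set i : {linear G -> R^o} * bdisk F | continuous i.1]
    (fun i (f : U -> G) (x : trace i.2) => i.1 (f (trace_incl x)) : R^o)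
    (fun i => @CM_open R (EB i.2) R^o M (trace i.2) b).

End CM.
Arguments CM {R F} G M b U.

(* Main.v *)
(** A bounded set of [E] lies in the unit ball of the Banach space [E_B] spanned
    by its closed disk hull [B], so [T] may be restricted to [E_B].  If all
    [ev_x \o T] are bounded, then [e |-> d^k (l \o T e \o i_D) (x) (v)] is
    continuous on [E_B], by induction on [k] and Banach-Steinhaus: it is a
    pointwise limit of difference quotients of functionals of order [k - 1]
    along a line, and lines are smooth curves, so they stay in [U] for a short
    time.
    The norm [jnorm_rho] is a weighted supremum of finite combinations of such
    functionals; that the norm of [T e] is finite for each [e] (for every [rho],
    or for all large [rho = n + 1]) therefore yields, by Banach-Steinhaus again,
    a bound [c * `|e|] on it for one [rho].  Conversely, boundedness in [C^[M]]
    gives boundedness of [l (T a x)] for every continuous functional [l], and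
    Mackey's theorem (Hahn-Banach and a sliding hump) concludes. *)
Require Import Defs.
From HB Require Import structures.
From mathcomp Require Import all_boot all_order all_algebra.
From mathcomp Require Import all_classical all_reals all_analysis.
From mathcomp Require Import lra.

Set Implicit Arguments.
Unset Strict Implicit.
Unset Printing Implicit Defensive.

Import Order.TTheory GRing.Theory Num.Theory.
Import numFieldNormedType.Exports.

Local Open Scope classical_set_scope.
Local Open Scope ring_scope.

(** * Continuous linear maps and uniform boundedness *)

Section linear_combinations.
Context {R : realType} {V W : lmodType R}.
Implicit Types (P : set (V -> W)) (f g : V -> W).

Definition pack_linear f (lf : linear f) : {linear V -> W} :=
  HB.pack f (GRing.isLinear.Build _ _ _ _ _ lf).

Definition lincomb_closed P := P (fun=> 0) /\
  forall (a : R) f g, P f -> P g -> P (fun x => a *: f x + g x).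

Lemma lincomb_closed_linear : lincomb_closed (fun f => linear f).
Proof.
split=> [a x y|a f g fl gl b x y]; first by rewrite scaler0 addr0.
by rewrite fl gl !scalerDr !scalerA mulrC addrACA.
Qed.

Lemma lincomb_closedZ P (a : R) f :
  lincomb_closed P -> P f -> P (fun x => a *: f x).
Proof.
move=> [P0 PD] Pf; have := PD a _ _ Pf P0.
by under eq_fun do rewrite addr0.
Qed.

Lemma lincomb_closedB P f g :
  lincomb_closed P -> P f -> P g -> P (fun x => f x - g x).
Proof.
move=> [_ PD] Pf Pg; have := PD (-1) _ _ Pg Pf.
by under eq_fun do rewrite scaleN1r addrC.
Qed.

Lemma lincomb_closed_sum P n (a : 'I_n -> R) (f : 'I_n -> V -> W) :
  lincomb_closed P -> (forall i, P (f i)) -> P (fun x => \sum_i a i *: f i x).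
Proof.
move=> [P0 PD]; elim: n a f => [|n IH] a f Pf.
  by under eq_fun do rewrite big_ord0.
by under eq_fun do rewrite big_ord_recl; exact/PD/IH.
Qed.

End linear_combinations.

Lemma linear_cvg (R : realType) (V : lmodType R) (W : normedModType R)
    (f : nat -> V -> W) (g : V -> W) :
  (forall n, linear (f n)) -> (forall x, f n x @[n --> \oo] --> g x) ->
  linear g.
Proof.
move=> fl fg a x y; have : f n (a *: x + y) @[n --> \oo] --> a *: g x + g y.
  have -> : f ^~ (a *: x + y) = fun n => a *: f n x + f n y.
    by apply/funext => n; rewrite fl.
  by apply: cvgD => //; exact: cvgZ (cvg_cst a) (fg x).
exact: (cvg_unique _ (fg _)).
Qed.

Section continuous_linear.
Context {R : realType} {V W : normedModType R}.
Implicit Types f g : V -> W.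

Definition continuous_linear f := linear f /\ continuous f.

Lemma continuous_linear_bounded f :
  continuous_linear f -> exists c, forall x, `|f x| <= c * `|x|.
Proof.
move=> [fl fc]; have /linear_boundedP[c [_ cf]] :=
  (linear_bounded_continuous (pack_linear fl)).2 fc.
by exists (c + 1); apply: cf; rewrite ltrDl.
Qed.

Lemma ball1_bounded_linear (f : {linear V -> W}) c :
  (forall x, `|x| <= 1 -> `|f x| <= c) -> forall x, `|f x| <= c * `|x|.
Proof.
move=> fc x; have [->|x0] := eqVneq x 0; first by rewrite linear0 !normr0 mulr0.
have nx0 : 0 < `|x| by rewrite normr_gt0.
rewrite -ler_pdivrMr// mulrC -[X in X * _]gtr0_norm ?invr_gt0//.
rewrite -normrZ -linearZ; apply: fc.
by rewrite normrZ normfV normr_id mulVf// gt_eqF.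
Qed.

Lemma linear_bounded_continuous_linear f c :
  linear f -> (forall x, `|f x| <= c * `|x|) -> continuous_linear f.
Proof.
move=> fl fc; split=> //.
apply/(linear_bounded_continuous (pack_linear fl))/linear_boundedP.
exists c; split=> [|d cd x]; first exact: num_real.
by rewrite (le_trans (fc x))// ler_wpM2r// ltW.
Qed.

Lemma lincomb_closed_continuous_linear : lincomb_closed continuous_linear.
Proof.
have [l0 lD] := @lincomb_closed_linear R V W.
split=> [|a f g [fl fc] [gl gc]].
  by split=> // x; exact: cvg_cst.
split; first exact: lD.
by move=> x; apply: cvgD (gc x); exact: cvgZ (cvg_cst a) (fc x).
Qed.

End continuous_linear.

Section uniform_boundedness.
Context {R : realType} {V : completeNormedModType R} {W : normedModType R}.

Lemma pointwise_bounded_uniform (F : set (V -> W)) :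
  F `<=` continuous_linear ->
  (forall x, exists c, forall f, F f -> `|f x| <= c) ->
  exists c, forall f, F f -> forall x, `|f x| <= c * `|x|.
Proof.
move=> Fcl Fpt; have Fbl f : F f -> bounded_fun_norm f /\ linear f.
  move=> Ff; have [c fc] := continuous_linear_bounded (Fcl f Ff).
  split; last exact: (Fcl f Ff).1.
  move=> r; exists (`|c| * r) => x xr; rewrite (le_trans (fc x))//.
  by rewrite (le_trans (ler_wpM2r _ (ler_norm c)))// ler_wpM2l.
have [c Fc] := Banach_Steinhauss Fbl Fpt 1; exists c => f Ff.
exact: (ball1_bounded_linear (f := pack_linear (Fcl f Ff).1) (Fc f Ff)).
Qed.

(* A sequence [f n \in F n] of counterexamples would still be pointwise bounded,
   contradicting Banach-Steinhaus. *)
Lemma eventually_bounded_uniform (F : nat -> set (V -> W)) :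
  (forall n, F n `<=` continuous_linear) ->
  (forall x, exists c, \forall n \near \oo, forall f, F n f -> `|f x| <= c) ->
  exists n c, forall f, F n f -> forall x, `|f x| <= c * `|x|.
Proof.
move=> Fcl Fpt; apply/not_existsP => unb.
have /choice[f fP] n : exists f, F n f /\ ~ forall x, `|f x| <= n%:R * `|x|.
  apply: contrapT => nf; apply: (unb n); exists n%:R => f Ff.
  by apply: contrapT => fn; apply: nf; exists f.
have [_ [n _ <-]||c cf] := @pointwise_bounded_uniform (range f).
- exact: Fcl (fP n).1.
- move=> x; have [c [N _ Nc]] := Fpt x; exists (\sum_(i < N) `|f i x| + `|c|).
  move=> _ [n _ <-]; have [nN|Nn] := ltnP n N.
    rewrite (bigD1 (Ordinal nN))//= -addrA lerDl addr_ge0//.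
    exact: sumr_ge0.
  rewrite (le_trans (Nc n Nn _ (fP n).1))// (le_trans (ler_norm c))// lerDr.
  exact: sumr_ge0.
have [_ []] := fP (Num.bound `|c|) => x.
apply: le_trans (cf (f _) _ x) _; first exact: imageT.
by rewrite ler_wpM2r// (le_trans (ler_norm c))// ltW// archi_boundP.
Qed.

Lemma continuous_linear_cvg (f : nat -> V -> W) (g : V -> W) :
  (forall n, continuous_linear (f n)) ->
  (forall x, f n x @[n --> \oo] --> g x) -> continuous_linear g.
Proof.
move=> fcl fg; have gl : linear g.
  by apply: linear_cvg fg => n; exact: (fcl n).1.
have [_ [n _ <-]//|x|c fc] := @pointwise_bounded_uniform (range f).
  have /cvg_seq_bounded/pinfty_ex_gt0[c _ /= fc] : cvgn (f ^~ x).
    by apply/cvg_ex; exists (g x).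
  by exists c => _ [n _ <-]; exact: fc.
apply: (@linear_bounded_continuous_linear _ _ _ _ c) => // x.
apply: (cvgr_to_le (cvg_norm (fg x))).
by apply: nearW => n; apply: fc; exists n.
Qed.

End uniform_boundedness.

(** * Hahn-Banach *)

Section hahn_banach.
Context {R : realType} {V : lmodType R}.
Implicit Types (p : V -> R) (G : set (V * R)).

Definition sublinear p := (forall x y, p (x + y) <= p x + p y) /\
  (forall t x, 0 <= t -> p (t *: x) = t * p x).

(* A linear functional on a subspace, given by its graph; domination by p makes
   the graph single-valued. *)
Definition dominated_graph p G := [/\ G (0, 0),
  forall a u v, G u -> G v -> G (a *: u.1 + v.1, a * u.2 + v.2) &
  forall u, G u -> u.2 <= p u.1].

Lemma dominated_graph_separation p G (x0 : V) : sublinear p ->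
  dominated_graph p G -> exists c : R, forall u, G u ->
    u.2 - p (u.1 - x0) <= c /\ c <= p (u.1 + x0) - u.2.
Proof.
move=> [pD _] [G0 Gl Gp]; pose S := [set u.2 - p (u.1 - x0) | u in G].
have Sub u v : G u -> G v -> u.2 - p (u.1 - x0) <= p (v.1 + x0) - v.2.
  move=> Gu Gv; have := Gp _ (Gl 1 u v Gu Gv); rewrite /= scale1r mul1r.
  by have := pD (u.1 - x0) (v.1 + x0); rewrite addrACA addNr addr0; lra.
have supS : has_sup S.
  split; first by exists (0 - p (0 - x0)), (0, 0).
  by exists (p (0 + x0) - 0) => _ [u Gu <-]; exact: (Sub u (0, 0)).
exists (sup S) => u Gu; split; first by apply: ub_le_sup supS.2 _ _; exists u.
by apply: (ge_sup supS.1) => _ [v Gv <-]; exact: Sub.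
Qed.

Lemma dominated_graph_extend p G (x0 : V) :
  sublinear p -> dominated_graph p G ->
  exists G', [/\ dominated_graph p G', G `<=` G' & exists a, G' (x0, a)].
Proof.
move=> sp Gdom; have [c sep] := dominated_graph_separation x0 sp Gdom.
have [G0 Gl Gp] := Gdom; have [_ pZ] := sp.
have GZ a u : G u -> G (a *: u.1, a * u.2).
  by move=> Gu; have := Gl a u (0, 0) Gu G0; rewrite /= !addr0.
exists [set w | exists t, G (w.1 - t *: x0, w.2 - t * c)]; split; first split.
- by exists 0; rewrite scale0r mul0r !subr0.
- move=> a u v [t Gt] [s Gs]; exists (a * t + s) => /=.
  have := Gl a _ _ Gt Gs; rewrite /= scalerBr mulrBr scalerDl mulrDl !opprD.
  rewrite scalerA mulrA [in X in G X -> _]addrACA.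
  by rewrite [in X in G (_, X) -> _]addrACA.
- move=> [x d] [t /=]; have [t0|t0|->] := ltgtP t 0.
  + have {}t0 : 0 < - t by rewrite oppr_gt0.
    move=> /(GZ (- t)^-1)/sep[+ _] /=.
    have -> : (- t)^-1 *: (x - t *: x0) - x0 = (- t)^-1 *: x.
      rewrite scalerBr scalerA -[t in _ * t]opprK mulrN mulVf ?gt_eqF//.
      by rewrite scaleN1r opprK addrK.
    rewrite pZ; last by rewrite invr_ge0 ltW.
    by rewrite -mulrBr ler_pdivrMl//=; lra.
  + move=> /(GZ t^-1)/sep[_] /=.
    have -> : t^-1 *: (x - t *: x0) + x0 = t^-1 *: x.
      by rewrite scalerBr scalerA mulVf ?gt_eqF// scale1r subrK.
    rewrite pZ; last by rewrite invr_ge0 ltW.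
    by rewrite -mulrBr ler_pdivlMl//=; lra.
  + by rewrite scale0r mul0r !subr0 => /Gp.
- by move=> [x d] Gxd; exists 0; rewrite scale0r mul0r !subr0.
- by exists c, 1; rewrite scale1r mul1r !subrr.
Qed.

Lemma dominated_graph_bigcup p (I : Type) (D : set I) (F : I -> set (V * R)) :
  D !=set0 -> (forall i, D i -> dominated_graph p (F i)) ->
  total_on D (fun i j => F i `<=` F j) ->
  dominated_graph p (\bigcup_(i in D) F i).
Proof.
move=> [i Di] Fp Ftot; split.
- by exists i => //; have [] := Fp i Di.
- move=> a u v [j Dj Fju] [k Dk Fkv].
  have [l [Dl Flu Flv]] : exists l, [/\ D l, F l u & F l v].
    have [jk|kj] := Ftot j k Dj Dk.
      by exists k; split=> //; exact: jk.
    by exists j; split=> //; exact: kj.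
  by exists l => //; have [_ Fl _] := Fp l Dl; exact: Fl.
- by move=> u [j Dj Fju]; have [_ _] := Fp j Dj; exact.
Qed.

Lemma dominated_graph_maximal p G : dominated_graph p G ->
  exists G', [/\ dominated_graph p G', G `<=` G' &
    forall X, dominated_graph p X -> G' `<=` X -> X `<=` G'].
Proof.
move=> Gp; pose P := [set A | dominated_graph p (A `|` G)].
have [C Cp Ctot|A [Ap Amax]] := @Zorn_bigcup _ P.
  have [->|/set0P C0] := eqVneq C set0.
    by rewrite /P /= bigcup_set0 set0U.
  rewrite /P /= -bigcupUl//; apply: dominated_graph_bigcup => // X Y CX CY.
  by have [XY|YX] := Ctot X Y CX CY; [left|right]; exact: setSU.
exists (A `|` G); split=> // X Xp; rewrite subUset => -[AX GX].
apply: subset_trans (@subsetUl _ _ _); apply: contrapT => XA.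
by apply: (Amax X) => //; rewrite /P /= (setUidl GX).
Qed.

Lemma dominated_graph_functional p G : sublinear p -> dominated_graph p G ->
  (forall x, exists a, G (x, a)) ->
  exists f : {linear V -> R^o}, (forall x, f x <= p x) /\
    forall x a, G (x, a) -> f x = a.
Proof.
move=> [pD pZ] [_ Gl Gp] /choice[f Gf].
have p0 : p 0 = 0 by have := pZ 0 0 (lexx 0); rewrite scale0r mul0r.
have le_value x a c : G (x, a) -> G (x, c) -> a <= c.
  move=> Ga Gc; have := Gp _ (Gl (-1) _ _ Gc Ga).
  by rewrite /= scaleN1r addNr p0; lra.
have f_value x a : G (x, a) -> f x = a.
  by move=> Ga; apply/eqP; rewrite eq_le !(le_value x).
have fl : linear (f : V -> R^o).
  by move=> a x y; apply: f_value; exact: (Gl a _ _ (Gf x) (Gf y)).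
by exists (pack_linear fl); split=> // x; exact: Gp (Gf x).
Qed.

Lemma hahn_banach p G : sublinear p -> dominated_graph p G ->
  exists f : {linear V -> R^o}, (forall x, f x <= p x) /\
    forall x a, G (x, a) -> f x = a.
Proof.
move=> sp /dominated_graph_maximal[M [Mp GM maxM]].
have [x|f [fp Mf]] := dominated_graph_functional sp Mp.
  have [M' [M'p MM' [a M'a]]] := dominated_graph_extend x sp Mp.
  by exists a; exact: maxM M'a.
by exists f; split=> // x a /GM/Mf.
Qed.

End hahn_banach.

(** * Seminorms and bounded sets of locally convex spaces *)

Section seminorms.
Context {R : realType} {V : lmodType R}.
Implicit Types p : V -> R.

Definition seminorm p :=
  (forall x y, p (x + y) <= p x + p y) /\ (forall a x, p (a *: x) = `|a| * p x).

Lemma seminorm0 p : seminorm p -> p 0 = 0.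
Proof. by move=> [_ /(_ 0 0)]; rewrite scale0r normr0 mul0r. Qed.

Lemma seminormN p x : seminorm p -> p (- x) = p x.
Proof. by move=> [_ pZ]; rewrite -scaleN1r pZ normrN normr1 mul1r. Qed.

Lemma seminorm_ge0 p x : seminorm p -> 0 <= p x.
Proof.
by move=> sp; have := sp.1 x (- x); rewrite subrr seminorm0// seminormN//; lra.
Qed.

Lemma seminorm_distr p x y : seminorm p -> `|p x - p y| <= p (y - x).
Proof.
move=> sp; have := sp.1 (y - x) x; have := sp.1 (x - y) y.
rewrite !subrK -(opprB y x) seminormN// ler_norml => *.
by apply/andP; split; lra.
Qed.

Lemma seminorm_normr (l : {linear V -> R^o}) : seminorm (fun x => `|l x|).
Proof.
split=> [x y|a x]; first by rewrite linearD; exact: ler_normD.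
by rewrite linearZ; exact: normrM.
Qed.

Lemma seminorm_norming_functional p v : seminorm p ->
  exists f : {linear V -> R^o}, (forall x, `|f x| <= p x) /\ f v = p v.
Proof.
move=> sp; have subp : sublinear p.
  by split=> [|t x t0]; [exact: sp.1|rewrite sp.2 ger0_norm].
pose G := [set (t *: v, t * p v) | t in setT].
have [|f [fp fv]] := hahn_banach (G := G) subp.
  split=> [|a _ _ [t _ <-] [s _ <-]|_ [t _ <-]] /=.
  - by exists 0 => //; rewrite scale0r mul0r.
  - by exists (a * t + s); rewrite // scalerDl mulrDl scalerA mulrA.
  - by rewrite sp.2 ler_wpM2r ?ler_norm// seminorm_ge0.
exists f; split; last by apply: fv; exists 1; rewrite ?scale1r ?mul1r.
move=> x; rewrite ler_norml fp andbT lerNl.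
by rewrite -[leRHS](seminormN _ sp) -linearN.
Qed.

End seminorms.

Local Notation gauge := Defs.minkowski.

Section gauges.
Context {R : realType} {V : lmodType R}.
Implicit Types W : set V.

Lemma absconvex0 W : absconvex W -> W 0.
Proof.
by move=> [[x Wx] /(_ 0 0 x x)]; rewrite !scale0r addr0 normr0 addr0; exact.
Qed.

Lemma absconvexZ W a x : absconvex W -> `|a| <= 1 -> W x -> W (a *: x).
Proof.
move=> [_ cW] a1 Wx; have := cW a 0 x x.
by rewrite scale0r addr0 normr0 addr0; exact.
Qed.

Lemma absconvex_convex_symmetric W : W 0 -> (forall x, W x -> W (- x)) ->
  (forall x y t, 0 <= t -> t <= 1 -> W x -> W y -> W (t *: x + (1 - t) *: y)) ->
  absconvex W.
Proof.
move=> W0 Ws Wc; split; first by exists 0.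
have {}Ws (a : R) x : W x -> exists2 x', W x' & a *: x = `|a| *: x'.
  have [a0|a0] := leP 0 a; first by exists x; rewrite // ger0_norm.
  by exists (- x); [exact: Ws|rewrite ltr0_norm// scalerN scaleNr opprK].
move=> a b x y ab /(Ws a)[x' Wx' ->] /(Ws b)[y' Wy' ->].
have [ab0|ab0] := eqVneq (`|a| + `|b|) 0.
  move: ab0 => /eqP; rewrite paddr_eq0// => /andP[/eqP -> /eqP ->].
  by rewrite !scale0r addr0.
have s0 : 0 < `|a| + `|b| by rewrite lt_def ab0 addr_ge0.
have := Wc x' y' (`|a| / (`|a| + `|b|)) (divr_ge0 (normr_ge0 _) (ltW s0)).
rewrite ler_pdivrMr// mul1r lerDl => /(_ (normr_ge0 _) Wx' Wy').
move=> /(Wc _ 0 (`|a| + `|b|) (ltW s0) ab)/(_ W0).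
rewrite scaler0 addr0 scalerDr !scalerA mulrBr mulr1 mulrC divfK ?gt_eqF//.
by rewrite [X in X - _]addrC addrK.
Qed.

Lemma gauge_ge0 W x : 0 <= gauge W x.
Proof.
rewrite /gauge; set S := (X in inf X); have [->|/set0P S0] := eqVneq S set0.
  by rewrite inf0.
by apply: lb_le_inf => // r [/ltW].
Qed.

Lemma gauge_le W x r : 0 < r -> W (r^-1 *: x) -> gauge W x <= r.
Proof.
move=> r0 Wx; apply: ge_inf; first by exists 0 => s [/ltW].
split=> //; exists (r^-1 *: x) => //.
by rewrite scalerKV ?gt_eqF.
Qed.

Lemma gauge_lt W x r : absconvex W -> (exists2 s, 0 < s & W (s^-1 *: x)) ->
  gauge W x < r -> W (r^-1 *: x).
Proof.
move=> aW [s s0 Wx] /inf_lt[|t [t0 [w Ww <-]] tr].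
  exists s; split=> //; exists (s^-1 *: x) => //.
  by rewrite scalerKV ?gt_eqF.
have r0 := lt_trans t0 tr.
rewrite scalerA; apply: absconvexZ => //.
by rewrite gtr0_norm ?mulr_gt0 ?invr_gt0// ler_pdivrMl// mulr1 ltW.
Qed.

Lemma seminorm_gauge W : absconvex W ->
  (forall x, exists2 r, 0 < r & W (r^-1 *: x)) -> seminorm (gauge W).
Proof.
move=> aW absW.
have gauge_gt x e : 0 < e -> 0 < gauge W x + e /\ W ((gauge W x + e)^-1 *: x).
  move=> e0; split; first by rewrite ltr_wpDl ?gauge_ge0.
  by apply: gauge_lt => //; rewrite ltrDl.
have pZ_le a x : a != 0 -> gauge W (a *: x) <= `|a| * gauge W x.
  move=> a0; have na0 : 0 < `|a| by rewrite normr_gt0.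
  rewrite -ler_pdivrMl//; apply/ler_addgt0Pr => e /(gauge_gt x)[r0 Wx].
  rewrite ler_pdivrMl//; apply: gauge_le; first exact: mulr_gt0.
  rewrite invfM scalerA mulrAC -scalerA; apply: absconvexZ => //.
  by rewrite normrM normfV normr_id mulVf ?gt_eqF.
split=> [x y|a x].
  apply/ler_addgt0Pr => e e0; have e20 : 0 < e / 2 by rewrite divr_gt0.
  have [r0 Wx] := gauge_gt x _ e20; have [s0 Wy] := gauge_gt y _ e20.
  set r := _ + _ in r0 Wx; set s := _ + _ in s0 Wy.
  have -> : gauge W x + gauge W y + e = r + s by rewrite /r /s; lra.
  have rs0 := addr_gt0 r0 s0; apply: gauge_le => //.
  have := aW.2 (r / (r + s)) (s / (r + s)) _ _ _ Wx Wy.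
  rewrite !scalerA ![_ / (r + s) / _]mulrAC !divff ?gt_eqF// !mul1r -scalerDr.
  by apply; rewrite !gtr0_norm ?divr_gt0// -mulrDl divff ?gt_eqF.
have [->|a0] := eqVneq a 0.
  rewrite scale0r normr0 mul0r; apply/eqP; rewrite eq_le gauge_ge0 andbT.
  apply/ler_addgt0Pr => e e0; rewrite add0r; apply: gauge_le => //.
  by rewrite scaler0; exact: absconvex0.
apply/eqP; rewrite eq_le pZ_le//= -ler_pdivlMl ?normr_gt0// -normfV.
by rewrite -[X in gauge W X <= _](scalerK a0) pZ_le// invr_eq0.
Qed.

End gauges.

Section bounded_sets.
Context {R : realType} {E : tvsType R}.
Implicit Types (A N : set E) (p : E -> R).

Lemma cvg_scalerB (T : Type) (H : set_system T) {FH : Filter H} (f : T -> E)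
    (a : R) (x y : E) :
  f @ H --> x -> a *: (f t - y) @[t --> H] --> a *: (x - y).
Proof.
move=> fx; apply: continuous2_cvg; first exact: (@scale_continuous R E (_, _)).
  exact: cvg_cst.
apply: continuous2_cvg fx (cvg_cst (- y)).
exact: (@add_continuous E (_, _)).
Qed.

Lemma nbhs0_absorbing N x : nbhs (0 : E) N ->
  exists2 r : R, 0 < r & N (r^-1 *: x).
Proof.
move=> N0; have := @scale_continuous R E (0, x) N.
rewrite /= scale0r => /(_ N0).
move=> [[P Q]/= [/nbhs_ballP[e /= e0 eP] Qx] PQN].
have e20 : 0 < e / 2 by rewrite divr_gt0.
exists (e / 2)^-1; first by rewrite invr_gt0.
rewrite invrK; apply: (PQN (e / 2, x)); split=> /=; last exact: nbhs_singleton.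
by apply: eP; rewrite /ball/= sub0r normrN gtr0_norm//; lra.
Qed.

Lemma nbhs0_absconvex N : nbhs (0 : E) N ->
  exists W, [/\ absconvex W, nbhs (0 : E) W & W `<=` N].
Proof.
move=> N0; have [Bs Bcvx [Bo Bb]] := @locally_convex R E.
have [U [BU U0] UN] := Bb 0 N N0.
have nU : nbhs (0 : E) U by apply: open_nbhs_nbhs; split=> //; exact: Bo.
have Uc x y (t : R) : 0 <= t -> t <= 1 -> U x -> U y ->
    U (t *: x + (1 - t) *: y).
  move=> t0 t1 Ux Uy; have := Bcvx U (mem_set BU) x y (Itv01 t0 t1).
  by move=> /(_ (mem_set Ux) (mem_set Uy)) /set_mem.
exists (U `&` -%R @^-1` U); split; last by move=> x [/UN].
  apply: absconvex_convex_symmetric => [|x [Ux UNx]|].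
  - by split; rewrite /= ?oppr0.
  - by split; rewrite /= ?opprK.
  - move=> x y t t0 t1 [Ux UNx] [Uy UNy].
    by split; [exact: Uc|rewrite /= opprD -!scalerN; exact: Uc].
apply: filterI => //; have := @opp_continuous E 0 U; rewrite oppr0.
by move=> /(_ nU).
Qed.

Lemma seminorm_continuous p :
  seminorm p -> nbhs (0 : E) [set x | p x < 1] -> continuous p.
Proof.
move=> sp p1 x; apply/cvgrPdist_lt => e e0.
have := @nbhsT _ _ _ x (nbhs0Z (lt0r_neq0 e0) p1).
apply: filterS => _ [_ [y py <-] <-] /=.
rewrite (le_lt_trans (seminorm_distr _ _ sp))// addrAC subrr add0r.
by rewrite sp.2 gtr0_norm// -ltr_pdivlMl// mulVf ?gt_eqF.
Qed.

Lemma nbhs0_seminorm N : nbhs (0 : E) N ->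
  exists p, [/\ seminorm p, continuous p & [set x | p x < 1] `<=` N].
Proof.
move=> /nbhs0_absconvex[W [aW nW WN]].
have absW x := nbhs0_absorbing x nW.
have sW := seminorm_gauge aW absW.
exists (gauge W); split=> //.
  apply: seminorm_continuous => //.
  have half_neq0 : (2^-1 : R) != 0 by rewrite invr_eq0 pnatr_eq0.
  apply: filterS (nbhs0Z half_neq0 nW) => _ [w Ww <-] /=.
  apply: (@le_lt_trans _ _ 2^-1); last by lra.
  by apply: gauge_le; [lra|rewrite scalerA mulVf// scale1r].
by move=> x /(gauge_lt aW (absW x)); rewrite invr1 scale1r => /WN.
Qed.

Lemma lcs_boundedP A : lcs_bounded (lcs_of_tvs E) A <->
  forall p, seminorm p -> continuous p -> exists c, forall a, A a -> p a <= c.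
Proof.
split=> [[_ bA] p sp cp|bA].
  have [|r r0 Ar] := bA [set x | p x < 1].
    by apply: (cvgr_lt _ (cp 0)); rewrite seminorm0.
  exists r => _ /Ar[x /= px <-].
  by rewrite sp.2 gtr0_norm// ger_pMr// ltW.
split=> // N /nbhs0_seminorm[p [sp cp pN]]; have [c Ac] := bA p sp cp.
have d0 : 0 < `|c| + 1 by rewrite ltr_wpDl.
exists (`|c| + 1) => // a Aa; exists ((`|c| + 1)^-1 *: a).
  apply: pN; rewrite /= sp.2 gtr0_norm ?invr_gt0// ltr_pdivrMl// mulr1.
  by rewrite (le_lt_trans (Ac a Aa))// (le_lt_trans (ler_norm c))// ltrDl.
by rewrite scalerKV ?gt_eqF.
Qed.

Lemma bounded_functional A (l : {linear E -> R^o}) : continuous l ->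
  lcs_bounded (lcs_of_tvs E) A -> exists c : R, forall a, A a -> `|l a| <= c.
Proof.
move=> cl /lcs_boundedP; apply; first exact: seminorm_normr.
by move=> x; exact: (cvg_norm (cl x)).
Qed.

Lemma linear_dominated_continuous (l : {linear E -> R^o}) p c : seminorm p ->
  continuous p -> (forall x, `|l x| <= c * p x) -> continuous l.
Proof.
move=> sp cp lp x; apply/cvgrPdist_lt => e e0.
have cp_lt : \forall z \near 0, c * p z < e.
  have cp0 : c * p z @[z --> 0] --> c * p 0 by exact: cvgM (cvg_cst c) (cp 0).
  by apply: (cvgr_lt _ cp0); rewrite seminorm0// mulr0.
apply: filterS (@nbhsT _ _ _ x cp_lt) => _ [z pz <-] /=.
by rewrite linearD opprD addrA subrr sub0r normrN; exact: le_lt_trans (lp z) pz.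
Qed.

End bounded_sets.

(** * Mackey's theorem *)

(* The signs are chosen one after the other, so that the term [e k * u k k]
   reinforces the preceding ones; it then outweighs the following ones. *)
Lemma sliding_hump (R : realFieldType) (u : nat -> nat -> R) :
  (forall n k, `|u n k| <= u k k) ->
  exists e : nat -> R, (forall n, `|e n| = 3^-1 ^+ n) /\
    forall k n, (k < n)%N ->
      3^-1 ^+ k / 2 * u k k <= `|series (fun i => e i * u i k) n|.
Proof.
move=> uu; pose q : R := 3^-1.
have q0 n : 0 < q ^+ n by rewrite exprn_gt0// invr_gt0.
pose sgn (x : R) : R := if 0 <= x then 1 else -1.
pose s := fix s n k :=
  if n is m.+1 then s m k + sgn (s m m) * q ^+ m * u m k else 0.
exists (fun n => sgn (s n n) * q ^+ n).
have sE n k : series (fun i => sgn (s i i) * q ^+ i * u i k) n = s n k.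
  by elim: n => [|n IH]; rewrite ?seriesSr ?IH// /series /= big_geq.
have e_norm n : `|sgn (s n n) * q ^+ n| = q ^+ n.
  rewrite normrM (gtr0_norm (q0 n)) /sgn.
  by case: ifP; rewrite ?normrN normr1 mul1r.
split=> [//|k n kn]; rewrite sE.
have u0 : 0 <= u k k by rewrite (le_trans _ (uu k k)).
suff: (q ^+ k + 3 * q ^+ n) / 2 * u k k <= `|s n k|.
  by apply: le_trans; rewrite ler_wpM2r// ler_pM2r// lerDl mulr_ge0// ltW.
have qS m : 3 * q ^+ m.+1 = q ^+ m.
  by rewrite exprS mulrA divff ?mul1r ?pnatr_eq0.
elim: n kn => // n IH; rewrite ltnS leq_eqVlt => /predU1P[->|kn].
  have -> : (q ^+ n + 3 * q ^+ n.+1) / 2 * u n n = q ^+ n * u n n.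
    by rewrite qS; lra.
  have := mulr_ge0 (ltW (q0 n)) (le_trans (normr_ge0 _) (uu n n)).
  rewrite /= /sgn; case: ifPn; rewrite -?ltNge => sn x0.
    by rewrite mul1r ler_normr lerDr sn.
  by rewrite ler_normr !mulNr mul1r opprD opprK lerDr oppr_ge0 (ltW sn) orbT.
rewrite qS /=; have := lerB_normD (s n k) (sgn (s n n) * q ^+ n * u n k).
rewrite normrM e_norm; have := ler_wpM2l (ltW (q0 n)) (uu n k).
by have := IH kn; lra.
Qed.

Lemma dominated_series (R : realType) (V : lmodType R) (p : V -> R)
    (f : nat -> {linear V -> R^o}) (e : nat -> R) (r : R) :
  (forall n x, `|f n x| <= p x) -> 0 < r -> r < 1 ->
  (forall n, `|e n| <= r ^+ n) ->
  exists g : {linear V -> R^o}, (forall x, `|g x| <= (1 - r)^-1 * p x) /\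
    forall x, series (fun n => e n * f n x) @ \oo --> g x.
Proof.
move=> fp r0 r1 er; have nr1 : `|r| < 1 by rewrite gtr0_norm.
have p0 x : 0 <= p x := le_trans (normr_ge0 _) (fp 0 x).
pose t x n : R := e n * f n x.
have t_le x n : `|t x n| <= geometric (p x) r n.
  by rewrite /t normrM mulrC ler_pM.
have t_cvg x : cvgn (series (t x)).
  apply: normed_cvg.
  apply: (series_le_cvg _ _ (t_le x) (is_cvg_geometric_series nr1)) => // n.
  exact: le_trans (t_le x n).
pose g x : R^o := limn (series (t x)).
have gl : linear g.
  apply: (linear_cvg (f := fun n x => series (t x) n : R^o)) => // n a x y.
  rewrite /series scaler_sumr -big_split; apply: eq_bigr => i _.
  by rewrite /t linearP mulrDr -![_ *: _]/(_ * _) mulrCA.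
exists (pack_linear gl); split=> [x|//].
apply: (cvgr_to_le (cvg_norm (t_cvg x))); apply: nearW => n.
rewrite (le_trans (ler_norm_sum _ _ _))// mulrC.
apply: le_trans (geometric_le_lim n (p0 x) r0 nr1).
exact: ler_sum.
Qed.

Lemma weakly_bounded (R : realType) (E : tvsType R) (A : set E) :
  (forall l : {linear E -> R^o}, continuous l ->
    exists c : R, forall a, A a -> `|l a| <= c) ->
  lcs_bounded (lcs_of_tvs E) A.
Proof.
move=> wA; apply/lcs_boundedP => p sp cp; apply: contrapT => /forallNP unb.
have /choice[a aP] k : exists a, A a /\ k%:R * 3 ^+ k < p a.
  apply: contrapT => na; apply: (unb (k%:R * 3 ^+ k)) => a Aa.
  by rewrite leNgt; apply/negP => pa; apply: na; exists a.
have /choice[f fP] k := seminorm_norming_functional (a k) sp.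
have [n k|e [e3 humps]] := @sliding_hump R (fun n k => f n (a k)).
  by rewrite (fP k).2 (fP n).1.
have fp n := (fP n).1.
have [||n|g [gp eg]] := dominated_series fp (_ : 0 < 3^-1) _ (e := e).
- by rewrite invr_gt0.
- by lra.
- by rewrite e3.
have [c gc] := wA g (linear_dominated_continuous sp cp gp).
pose k := Num.bound `|2 * c|.
have : 3^-1 ^+ k / 2 * p (a k) <= c.
  apply: le_trans (gc _ (aP k).1); rewrite -{1}(fP k).2.
  apply: (cvgr_to_ge (cvg_norm (eg (a k)))).
  by near=> n; apply: humps; near: n; exact: nbhs_infty_gt.
rewrite exprVn -mulrA ler_pdivrMl ?exprn_gt0// => pa_le.
have : 2 * c * 3 ^+ k < k%:R * 3 ^+ k.
  by rewrite ltr_pM2r ?exprn_gt0// (le_lt_trans (ler_norm _))// archi_boundP.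
by have := (aP k).2; lra.
Unshelve. all: by end_near. Qed.

(** * The Banach spaces spanned by bounded disks *)

Section disk_hull.
Context {R : realType} {E : tvsType R}.
Implicit Types A : set E.

Definition disk_hull A : set E := smallest (fun D => closed D /\ absconvex D) A.

Lemma disk_hull_closed A : closed (disk_hull A).
Proof. by apply: closed_bigI => D [[]]. Qed.

Lemma disk_hull_absconvex A : absconvex (disk_hull A).
Proof.
split; first by exists 0 => D [[_ /absconvex0]].
by move=> a b x y ab Ax Ay D AD; apply: AD.1.2.2 => //; [exact: Ax|exact: Ay].
Qed.

Lemma seminorm_disk_hull A p c : seminorm p -> continuous p -> 0 <= c ->
  (forall a, A a -> p a <= c) -> forall x, disk_hull A x -> p x <= c.
Proof.
move=> sp cp c0 pc; apply: smallest_sub => //; split.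
  apply: (@preimage_closed _ _ p [set t | t <= c]); last exact: closed_le.
  by move=> x _; exact: cp.
split; first by exists 0; rewrite /= seminorm0.
move=> a b x y ab px py; rewrite /= (le_trans (sp.1 _ _))// !sp.2.
apply: (@le_trans _ _ ((`|a| + `|b|) * c)); last by rewrite ler_piMl.
by rewrite mulrDl lerD// ler_wpM2l.
Qed.

Lemma disk_hull_bounded A : lcs_bounded (lcs_of_tvs E) A ->
  lcs_bounded (lcs_of_tvs E) (disk_hull A).
Proof.
move=> /lcs_boundedP bA; apply/lcs_boundedP => p sp cp.
have [c Ac] := bA p sp cp; exists `|c|; apply: seminorm_disk_hull => // a Aa.
by rewrite (le_trans (Ac a Aa))// ler_norm.
Qed.

Lemma bounded_set1 (x : E) : lcs_bounded (lcs_of_tvs E) [set x].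
Proof. by apply/lcs_boundedP => p _ _; exists (p x) => _ ->. Qed.

End disk_hull.

Definition hull_bdisk (R : realType) (E : convenientType R) (A : set E)
    (bA : lcs_bounded (lcs_of_tvs E) A) : bdisk E :=
  MkBdisk (@disk_hull_closed _ _ A) (@disk_hull_absconvex _ _ A)
    (disk_hull_bounded bA).

Lemma cauchy_sequences_complete (R : realType) (V : normedModType R) :
  (forall x : nat -> V,
    (forall n m, `|x n - x m| <= n.+1%:R^-1 + m.+1%:R^-1) -> cvgn x) ->
  forall F : set_system V, ProperFilter F -> cauchy F -> cvg F.
Proof.
move=> Vseq F PF /cauchyP Fcauchy.
have n0 n : 0 < n.+1%:R^-1 :> R by rewrite invr_gt0.
have /choice[x Fx] n : exists y, F (ball y n.+1%:R^-1) by exact: Fcauchy.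
have /cvg_ex[l xl] : cvgn x.
  apply: Vseq => n m; have [y []] := filter_ex (filterI (Fx n) (Fx m)).
  rewrite -!ball_normE /ball_ /= => xny xmy.
  by rewrite (le_trans (ler_distD y _ _))// lerD// ltW// distrC.
apply/cvg_ex; exists l; apply/cvgrPdist_lt => e e0.
have e20 : 0 < e / 2 by rewrite divr_gt0.
have [n [xnl n_lt]] : exists n, `|l - x n| < e / 2 /\ n.+1%:R^-1 < e / 2.
  apply: (@filter_ex _ \oo); apply: filterI.
    by move/cvgrPdist_lt : xl; exact.
  exact: (cvgr_lt _ cvg_harmonic _ e20).
apply: filterS (Fx n) => y; rewrite -ball_normE /ball_ /= => xny.
rewrite (le_lt_trans (ler_distD (x n) _ _))// [e]splitr ltrD//.
exact: lt_trans xny n_lt.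
Qed.

Section EB_complete.
Context {R : realType} {E : convenientType R} (B : bdisk E).
Local Notation D := (bdisk_set B).
Implicit Types x : EB B.

Lemma bdisk_EB_pred (y : E) r : 0 < r -> D (r^-1 *: y) -> y \in EB_pred B.
Proof.
move=> r0 Dy; rewrite -[y](scalerKV (lt0r_neq0 r0)) rpredZ//.
by apply/mem_set; exact: sub_gen_smallest.
Qed.

Lemma EB_norm_le x r : 0 < r -> D (r^-1 *: EB_incl x) -> `|x| <= r.
Proof. exact: gauge_le. Qed.

Lemma EB_norm_lt x r : `|x| < r -> D (r^-1 *: EB_incl x).
Proof.
have aD := bdisk_absconvex B; have [->|x0] := eqVneq x 0 => xr.
  by rewrite -[EB_incl _]/(0 : E) scaler0; exact: absconvex0.
(* If no multiple of D contained x, then `|x| would be inf set0 = 0. *)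
apply: gauge_lt xr => //; apply: contrapT => Dx; move: x0; rewrite -normr_eq0.
rewrite -[`|x|]/(inf _); set S := (X in inf X).
have [->|/set0P[s [s0 [d Dd dx]]]] := eqVneq S set0; first by rewrite inf0 eqxx.
by case: Dx; exists s => //; rewrite -dx scalerK ?gt_eqF.
Qed.

Lemma continuous_linear_EB_incl (W : normedModType R) (f : {linear E -> W}) c :
  (forall y, D y -> `|f y| <= c) ->
  continuous_linear (fun x : EB B => f (EB_incl x)).
Proof.
move=> fc; have fl : linear (fun x : EB B => f (EB_incl x)).
  by move=> a x y; rewrite -linearP.
apply: (linear_bounded_continuous_linear (c := 2 * c)) => //.
apply: (ball1_bounded_linear (f := pack_linear fl)) => x x1.
have /fc : D (2^-1 *: EB_incl x).
  by apply: EB_norm_lt; rewrite (le_lt_trans x1)// ltr1n.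
by rewrite linearZ normrZ gtr0_norm ?invr_gt0// ler_pdivrMl.
Qed.

Lemma EB_cauchy_cvg (x : nat -> EB B) :
  (forall n m, `|x n - x m| <= n.+1%:R^-1 + m.+1%:R^-1) -> cvgn x.
Proof.
move=> xC; pose r n m : R := 2 * (n.+1%:R^-1 + m.+1%:R^-1).
have r0 n m : 0 < r n m by rewrite mulr_gt0// addr_gt0// invr_gt0.
have x_lt n m : `|x n - x m| < r n m.
  by rewrite (le_lt_trans (xC n m))// /r ltr_pMl ?ltr1n// addr_gt0// invr_gt0.
have [|l xl] := @convenient_complete R E (@EB_incl _ _ B \o x).
  exists D; split; [exact: bdisk_bounded|exact: bdisk_absconvex|].
  exists (fun nm => r nm.1 nm.2) => [|n m].
    rewrite -(mulr0 2) -(addr0 0); apply: cvgM; first exact: cvg_cst.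
    apply: cvgD; first exact: (cvg_comp fst harmonic cvg_fst cvg_harmonic).
    exact: (cvg_comp snd harmonic cvg_snd cvg_harmonic).
  exists ((r n m)^-1 *: EB_incl (x n - x m)); first exact: EB_norm_lt.
  by rewrite scalerKV ?gt_eqF.
have Dl n : D ((r n n)^-1 *: (l - EB_incl (x n))).
  have cl : (r n n)^-1 *: (EB_incl (x m) - EB_incl (x n)) @[m --> \oo] -->
      (r n n)^-1 *: (l - EB_incl (x n)).
    exact: cvg_scalerB.
  apply: closed_cvg cl; first exact: bdisk_closed.
  exists n => // m /= nm; apply: (EB_norm_lt (x := x m - x n)).
  rewrite (lt_le_trans (x_lt m n))// /r ler_pM2l// lerD2r.
  by rewrite lef_pV2 ?posrE ?ltr0n// ler_nat ltnS.
have lB : l \in EB_pred B.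
  rewrite -(subrK (EB_incl (x 0)) l) rpredD ?EB_inclP//.
  exact: bdisk_EB_pred (r0 0 0) (Dl 0).
apply/cvg_ex; exists (MkEB lB : EB B); apply/cvgrPdist_le => e e0.
have r_cvg0 : r n n @[n --> \oo] --> 0.
  rewrite -(mulr0 2) -(addr0 0); apply: cvgM; first exact: cvg_cst.
  by apply: cvgD; exact: cvg_harmonic.
apply: filterS (cvgr_le _ r_cvg0 _ e0) => n; apply: le_trans.
by apply: EB_norm_le => //; exact: Dl.
Qed.

HB.instance Definition _ :=
  Uniform_isComplete.Build (EB B) (cauchy_sequences_complete EB_cauchy_cvg).

End EB_complete.

(** * Derivatives as limits of difference quotients *)

Section frechet_jet.
Context {R : realType} {X F : normedModType R}.

Definition frechet_jet (U : set X) (f : U -> F) : jet X F X :=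
  xget 0 (frechet_derivs f).

Lemma frechet_jetP (U : set X) (f : U -> F) :
  frechet_smooth f -> frechet_derivs f (frechet_jet f).
Proof. by move=> [D fD]; exact: xgetPex (ex_intro _ D fD). Qed.

Lemma frechet_jet0 (U : set X) (f : U -> F) (x : U) (v : 'I_0 -> X) :
  frechet_smooth f -> frechet_jet f 0 (val x) v = f x.
Proof. by move=> /frechet_jetP[]. Qed.

Definition tail_args k (v : 'I_k.+1 -> X) : 'I_k -> X :=
  fun i => v (lift ord0 i).

Lemma padl_tail_args k (v : 'I_k.+1 -> X) : padl 1 (v ord0) (tail_args v) = v.
Proof.
apply/funext => i; rewrite /padl; case: (split_ordP i) => j ->.
  by congr v; apply/val_inj; rewrite /= (ord1 j).
by congr v; apply/val_inj.
Qed.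

Lemma lsym_eval_cvg (T : Type) (H : set_system T) {FH : Filter H} k
    (l : T -> Lsym k X F) (m : Lsym k X F) (v : 'I_k -> X) :
  l @ H --> m -> l t v @[t --> H] --> m v.
Proof.
move=> lm; apply/cvgrPdist_le => e e0; pose C := \prod_i `|v i| + 1.
have C0 : 0 < C by rewrite ltr_wpDl// prodr_ge0.
have /cvgrPdist_le/(_ (e / C) (divr_gt0 e0 C0)) := lm.
apply: filterS => t lt; rewrite -[m v - l t v]/((m - l t) v).
rewrite (le_trans (opnormP _ _))//.
apply: (@le_trans _ _ (e / C * C)); last by rewrite divfK ?gt_eqF.
by rewrite ler_pM ?opnorm_ge0 ?prodr_ge0// lerDl.
Qed.

Lemma frechet_derivs_cvg (U : set X) (f : U -> F) (D : jet X F X) k x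
    (v : 'I_k.+1 -> X) : frechet_derivs f D -> U x ->
  t^-1 *: (D k (x + t *: v ord0) (tail_args v) - D k x (tail_args v))
    @[t --> (0 : R)^'] --> D k.+1 x v.
Proof.
move=> [_ dD] Ux; have [dfx dE] := dD k x Ux.
set h := v ord0; set w := tail_args v.
have -> : D k.+1 x v = lsym_plug 1 (D (1 + k)%N x) h w.
  by rewrite -[RHS]/(D k.+1 x (padl 1 h w)) padl_tail_args.
have Dh : t^-1 *: (D k (t *: h + x) - D k x) @[t --> (0 : R)^'] -->
    lsym_plug 1 (D (1 + k)%N x) h.
  by rewrite -[lsym_plug _ _ _]/((fun h => lsym_plug 1 (D (1 + k)%N x) h) h) -dE
    -deriveE//; exact: diff_derivable.
rewrite (_ : (fun t => _) = (fun t => (t^-1 *: (D k (t *: h + x) - D k x)) w)).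
  exact: lsym_eval_cvg.
by apply/funext => t; rewrite [t *: h + x]addrC.
Qed.

End frechet_jet.

Definition radially_open (R : realType) (V : lmodType R) (U : set V) :=
  forall x h, U x -> \forall t \near (0 : R), U (x + t *: h).

Lemma frechet_jet_continuous_linear (R : realType) (V : completeNormedModType R)
    (X F : normedModType R) (U : set X) (f : V -> U -> F) : radially_open U ->
  (forall e, frechet_smooth (f e)) ->
  (forall x, continuous_linear (fun e => f e x)) ->
  forall k x (v : 'I_k -> X), U x ->
    continuous_linear (fun e => frechet_jet (f e) k x v).
Proof.
move=> oU sf fcl; have clc := @lincomb_closed_continuous_linear R V F.
elim=> [|k IH] x v Ux.
  have := fcl (exist _ x (mem_set Ux)); congr continuous_linear.
  by apply/funext => e; rewrite -(frechet_jet0 _ v (sf e)).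
pose w := tail_args v.
pose q t e :=
  t^-1 *: (frechet_jet (f e) k (x + t *: v ord0) w - frechet_jet (f e) k x w).
have harmonic_neq0 : @harmonic R @ \oo `=>` 0^'.
  move=> P /= /(@cvg_harmonic R); apply: (@filterS _ \oo) => n; apply.
  by rewrite /harmonic /= invr_eq0 pnatr_eq0.
have [N _ UN] := @cvg_harmonic R _ (oU x (v ord0) Ux).
apply: (continuous_linear_cvg (f := fun n => q (harmonic (n + N)%N))) => [n|e].
  apply: lincomb_closedZ => //; apply: lincomb_closedB => //; apply: IH => //.
  by apply: UN; rewrite /= leq_addl.
rewrite (@cvg_shiftn N F (fun n => q (harmonic n) e)).
exact: (cvg_comp _ (q^~ e) harmonic_neq0
  (frechet_derivs_cvg (frechet_jetP (sf e)) Ux)).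
Qed.

Lemma smooth_curve_line (R : realType) (E : tvsType R) (x h : E) :
  smooth_curve (fun t : R => x + t *: h).
Proof.
exists (fun n t =>
  if n is n'.+1 then if n' is _.+1 then 0 else h else x + t *: h) => //.
have near_cst (g : R -> E) (l : E) : (forall s : R, s != 0 -> g s = l) ->
    g s @[s --> (0 : R)^'] --> l.
  move=> gl; apply: (@cvg_trans _ (l @[s --> (0 : R)^'])); last exact: cvg_cst.
  by apply: near_eq_cvg; near=> s; rewrite gl//; near: s; exact: nbhs_dnbhs_neq.
move=> [|[|n]] t; apply: near_cst => s s0; rewrite ?subrr ?scaler0//.
rewrite opprD addrACA subrr add0r -scalerBl addrAC subrr add0r.
by rewrite scalerA mulVf// scale1r.
Unshelve. all: by end_near. Qed.

Lemma cinfty_open_radially_open (R : realType) (E : tvsType R) (U : set E) :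
  cinfty_open U -> radially_open U.
Proof.
move=> oU x h Ux; have := oU _ (smooth_curve_line x h).
by rewrite openE => /(_ 0); rewrite /= scale0r addr0 => /(_ Ux).
Qed.

(** * Jet norms *)

Definition unit_tuple (R : realType) (X : normedModType R) k (v : 'I_k -> X) :=
  forall i, `|v i| <= 1.

Lemma opnorm_leP (R : realType) (X F : normedModType R) k (l : Lsym k X F) c :
  `|l| <= c <-> forall v, unit_tuple v -> `|l v| <= c.
Proof.
split=> [lc v v1|lc]; first by apply: le_trans lc; exact: opnorm_ub.
apply: ge_sup; first exact: (opnorm_has_sup l).1.
by move=> _ [v v1 <-]; exact: lc.
Qed.

Lemma sup0_image_leP (R : realType) (I : Type) (D : set I) (g : I -> \bar R) c :
  0 <= c ->
  (Defs.sup0 [set g i | i in D] <= c%:E)%E <-> forall i, D i -> (g i <= c%:E)%E.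
Proof.
move=> c0; split=> [gc i Di|gc].
  by apply: le_trans gc; apply: ereal_sup_ubound; right; exists i.
by apply: ge_ereal_sup => _ [->|[i Di <-]]; [rewrite lee_fin|exact: gc].
Qed.

Section jet_norms.
Context {R : realType} {X F : normedModType R} (M : nat -> R) (K : set X).
Hypothesis wM : weight_sequence M.
Local Notation J := (jet X F K).
Implicit Types (g h : J) (rho tau c : R).

Definition jet_weight rho m : R := m`!%:R * rho ^+ m * M m.

Lemma jet_weight_gt0 rho m : 0 < rho -> 0 < jet_weight rho m.
Proof.
move=> rho0; have [M0 _ _] := wM.
by rewrite !mulr_gt0 ?ltr0n ?fact_gt0 ?exprn_gt0.
Qed.

Lemma jet_weight_le rho tau m : 0 < rho -> rho <= tau ->
  jet_weight rho m <= jet_weight tau m.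
Proof.
move=> rho0 rt; have [M0 _ _] := wM; have tau0 := lt_le_trans rho0 rt.
rewrite ler_pM2r// ler_pM2l ?ltr0n ?fact_gt0//.
by rewrite lerXn2r ?nnegrE ?(ltW rho0) ?(ltW tau0).
Qed.

(* jnorm_rho is the supremum of the norms of these maps, those of index m being
   divided by jet_weight rho m. *)
Variant norming_map : nat -> (J -> F) -> Prop :=
| NormingValue m (x : K) (v : 'I_m -> X) of unit_tuple v :
    norming_map m (fun g => g m x v)
| NormingRemainder n k (x y : K) (v : 'I_k -> X) of
    x <> y & unit_tuple v :
    norming_map (n + k).+1
      (fun g => (n.+1`!%:R / `|val x - val y| ^+ n.+1) *: jrem g n k y x v).

Definition jet_bounded rho c g :=
  forall m psi, norming_map m psi -> `|psi g| <= c * jet_weight rho m.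

Lemma jnorm_leP g m c : 0 <= c -> (jnorm g m <= c%:E)%E <->
  forall x (v : 'I_m -> X), unit_tuple v -> `|g m x v| <= c.
Proof.
move=> c0; split=> [/(sup0_image_leP _ _ c0) gc x v|gc].
  by have := gc x I; rewrite lee_fin => /opnorm_leP; exact.
by apply/sup0_image_leP => // x _; rewrite lee_fin; apply/opnorm_leP; exact: gc.
Qed.

Lemma jremnorm_leP g n k c : 0 <= c -> (jremnorm g n k <= c%:E)%E <->
  forall x y (v : 'I_k -> X), x <> y -> unit_tuple v ->
  `|(n.+1`!%:R / `|val x - val y| ^+ n.+1) *: jrem g n k y x v| <= c.
Proof.
move=> c0; have coef_gt0 (x y : K) : x <> y ->
    0 < n.+1`!%:R / `|val x - val y| ^+ n.+1 :> R.
  move=> xy; rewrite divr_gt0 ?ltr0n ?fact_gt0// exprn_gt0// normr_gt0 subr_eq0.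
  by apply/eqP => /val_inj.
split=> [/(sup0_image_leP _ _ c0) gc x y v xy v1|gc].
  have := gc (x, y) xy; rewrite lee_fin /= mulrAC -ler_pdivlMl ?coef_gt0//.
  move=> /opnorm_leP/(_ v v1); rewrite ler_pdivlMl ?coef_gt0//.
  by rewrite normrZ gtr0_norm ?coef_gt0.
apply/sup0_image_leP => // -[x y] xy; rewrite lee_fin /= mulrAC.
rewrite -ler_pdivlMl ?coef_gt0//; apply/opnorm_leP => v v1.
have := gc x y v xy v1; rewrite normrZ gtr0_norm ?coef_gt0//.
by rewrite ler_pdivlMl ?coef_gt0.
Qed.

Lemma jnorm_rho_leP rho c g : 0 < rho -> 0 <= c ->
  (jnorm_rho M rho g <= c%:E)%E <-> jet_bounded rho c g.
Proof.
move=> rho0 c0; have w0 m := jet_weight_gt0 m rho0.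
have cw0 m : 0 <= c * jet_weight rho m by rewrite mulr_ge0// ltW.
rewrite /jnorm_rho ge_max; split=> [/andP[]|gc].
  move=> /(sup0_image_leP _ _ c0) gv /(sup0_image_leP _ _ c0) gr _ _ [].
    move=> m x v v1; have := gv m I; rewrite lee_pdivrMr ?w0// -EFinM.
    by move=> /(jnorm_leP _ _ (cw0 m)); exact.
  move=> n k x y v xy v1; have := gr (n, k) I.
  rewrite /= lee_pdivrMr ?(w0 (n + k).+1)// -EFinM.
  by move=> /(jremnorm_leP _ _ _ (cw0 _)); exact.
apply/andP; split; apply/sup0_image_leP => //.
  move=> m _; rewrite lee_pdivrMr ?w0// -EFinM.
  apply/(jnorm_leP _ _ (cw0 m)) => x v v1.
  exact: gc (NormingValue x v1).
move=> [n k] _; rewrite /= lee_pdivrMr ?(w0 (n + k).+1)// -EFinM.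
apply/(jremnorm_leP _ _ _ (cw0 (n + k).+1)) => x y v xy v1.
exact: gc (NormingRemainder n xy v1).
Qed.

Lemma jrem_eval g n k (x y : K) (v : 'I_k -> X) : jrem g n k y x v =
  g k x v - \sum_(j < n.+1)
    j`!%:R^-1 *: g (j + k)%N y (padl j (val x - val y) v).
Proof.
have sum_eval (l : 'I_n.+1 -> Lsym k X F) : (\sum_j l j) v = \sum_j l j v.
  by elim/big_rec2 : _ => // i a b _ <-.
by rewrite -[LHS]/(g k x v - (\sum_(j < n.+1) j`!%:R^-1 *:
  lsym_plug j (g (j + k)%N y) (val x - val y)) v) sum_eval.
Qed.

Lemma norming_map_lincomb (V : lmodType R) (S : V -> J) (P : set (V -> F))
    m psi :
  lincomb_closed P -> (forall k x (v : 'I_k -> X), P (fun e => S e k x v)) ->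
  norming_map m psi -> P (fun e => psi (S e)).
Proof.
move=> Pl PS [{}m x v _|n k x y v _ _]; first exact: PS.
under eq_fun do rewrite jrem_eval.
apply: lincomb_closedZ => //; apply: lincomb_closedB => //.
exact: lincomb_closed_sum.
Qed.

Lemma norming_map_linear m psi : norming_map m psi -> linear psi.
Proof.
apply: (norming_map_lincomb (S := id) lincomb_closed_linear) => k x v a g h.
by [].
Qed.

Lemma jet_bounded_le rho tau c g : 0 < rho -> rho <= tau -> 0 <= c ->
  jet_bounded rho c g -> jet_bounded tau c g.
Proof.
move=> rho0 rt c0 gc m psi mpsi.
by rewrite (le_trans (gc m psi mpsi))// ler_wpM2l// jet_weight_le.
Qed.

Lemma jet_bounded_lincomb rho a b c d g h :
  jet_bounded rho c g -> jet_bounded rho d h ->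
  jet_bounded rho (`|a| * c + `|b| * d) (a *: g + b *: h).
Proof.
move=> gc hd m psi mpsi; pose psiL := pack_linear (norming_map_linear mpsi).
rewrite -[psi _]/(psiL _) linearD !linearZ /= mulrDl -!mulrA.
by rewrite (le_trans (ler_normD _ _))// !normrZ lerD// ler_wpM2l// ?gc ?hd.
Qed.

Lemma CM_rho_carrierP rho g : 0 < rho -> lcs_carrier (CM_rho M K rho) g <->
  (forall k, continuous (g k)) /\ exists2 c, 0 <= c & jet_bounded rho c g.
Proof.
move=> rho0; split=> [[gk gfin]|[gk [c c0 /(jnorm_rho_leP _ rho0 c0) gc]]].
  split=> //; have g0 : (0 <= jnorm_rho M rho g)%E.
    by rewrite le_max ereal_sup_ubound//; left.
  exists (fine (jnorm_rho M rho g)); first exact: fine_ge0.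
  by apply/jnorm_rho_leP => //; [exact: fine_ge0|rewrite fineK// ge0_fin_numE].
by split=> //; exact: le_lt_trans gc (ltry c).
Qed.

Lemma CM_rho_carrier_le rho tau g : 0 < rho -> rho <= tau ->
  lcs_carrier (CM_rho M K rho) g -> lcs_carrier (CM_rho M K tau) g.
Proof.
move=> rho0 rt /(CM_rho_carrierP _ rho0)[gk [c c0 gc]].
apply/(CM_rho_carrierP _ (lt_le_trans rho0 rt)); split=> //.
by exists c => //; exact: jet_bounded_le gc.
Qed.

Lemma CM_rho_carrier_lincomb rho a b g h : 0 < rho ->
  lcs_carrier (CM_rho M K rho) g -> lcs_carrier (CM_rho M K rho) h ->
  lcs_carrier (CM_rho M K rho) (a *: g + b *: h).
Proof.
move=> rho0 /(CM_rho_carrierP _ rho0)[gk [c c0 gc]].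
move=> /(CM_rho_carrierP _ rho0)[hk [d d0 hd]].
apply/CM_rho_carrierP => //; split.
  move=> k; suff : continuous (fun y => a *: g k y + b *: h k y) by [].
  move=> y; have ag : a *: g k z @[z --> y] --> a *: g k y.
    exact: cvgZ (cvg_cst a) (gk k y).
  have bh : b *: h k z @[z --> y] --> b *: h k y.
    exact: cvgZ (cvg_cst b) (hk k y).
  exact: cvgD ag bh.
exists (`|a| * c + `|b| * d); first by rewrite addr_ge0 ?mulr_ge0.
exact: jet_bounded_lincomb.
Qed.

Lemma CM_compact_Roumieu_absconvex :
  absconvex (lcs_carrier (CM_compact M K Roumieu : lcs J)).
Proof.
split.
  exists 0; exists 1; first exact: ltr01.
  apply: (CM_rho_carrierP _ ltr01).2; split=> [k|].
    exact: (@cst_continuous _ _ (0 : Lsym k X F)).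
  exists 0 => // m psi mpsi.
  have -> : psi 0 = 0 by exact: linear0 (pack_linear (norming_map_linear mpsi)).
  by rewrite normr0 mul0r.
move=> a b g h _ [rho rho0 grho] [tau tau0 htau].
have max0 : 0 < Num.max rho tau by rewrite lt_max rho0.
exists (Num.max rho tau) => //; apply: CM_rho_carrier_lincomb => //.
  by apply: CM_rho_carrier_le grho => //; rewrite le_max lexx.
by apply: CM_rho_carrier_le htau => //; rewrite le_max lexx orbT.
Qed.

Lemma CM_rho_value_nbhs0 rho (x : K) (v : 'I_0 -> X) : 0 < rho ->
  lcs_nbhs0 (CM_rho M K rho) [set g : J | `|g 0 x v| <= 1].
Proof.
move=> rho0; exists 1 => // g [_ /ltW/(jnorm_rho_leP _ rho0 ler01)].
have v1 : unit_tuple v by case.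
move=> /(_ _ _ (NormingValue x v1)); have [_ M0 _] := wM.
by rewrite /jet_weight expr0 M0 !mulr1.
Qed.

Lemma CM_compact_value_nbhs0 (x : K) (v : 'I_0 -> X) (b : flavour) :
  lcs_nbhs0 (CM_compact M K b) [set g : J | `|g 0 x v| <= 1].
Proof.
pose N := [set g : J | `|g 0 x v| <= 1].
case: b => /=.
  move=> H [_]; apply; exists 1; first exact: ltr01.
  by exists N => //; exact: CM_rho_value_nbhs0.
set Y := \bigcup_(rho in _) _; have acY : absconvex Y.
  exact: CM_compact_Roumieu_absconvex.
exists (Y `&` N); split; [|by move=> g []| |by move=> g []].
  split; first by exists 0; split; [exact: absconvex0|rewrite /N /= normr0].
  move=> a c g h ac [Yg g1] [Yh h1]; split; first exact: acY.2.
  rewrite /N /= -[(_ + _) _]/(a *: g 0 x v + c *: h 0 x v).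
  rewrite (le_trans (ler_normD _ _))// !normrZ (le_trans _ ac)//.
  by rewrite lerD// ler_piMr.
move=> rho rho0; have [e e0 eN] := CM_rho_value_nbhs0 x v rho0.
exists e => // g [gX ge]; split; last exact: eN.
by exists rho.
Qed.

End jet_norms.

(** * Continuity at the origin and boundedness *)

Section lcs_initial.
Context {R : realType} {V : lmodType R} (C : set V) (I : Type) (D : set I).
Context (W : I -> lmodType R) (f : forall i, V -> W i).
Context (Y : forall i, lcs (W i)).

Lemma lcs_initial_nbhs0 i N : D i -> lcs_nbhs0 (Y i) N ->
  lcs_nbhs0 (lcs_initial C D f Y) (f i @^-1` N).
Proof. by move=> Di YN; apply: sub_gen_smallest; exists i => //; exists N. Qed.

Lemma lcs_initial_cvg (H : set_system V) : Filter H ->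
  (forall i, D i -> f i @ H `=>` lcs_nbhs0 (Y i)) ->
  H `=>` lcs_nbhs0 (lcs_initial C D f Y).
Proof.
move=> FH fY; apply: smallest_sub => // _ [i Di [N YN <-]].
exact: fY YN.
Qed.

End lcs_initial.

Section lcs_bounded.
Context {R : realType} {W : lmodType R} (Y : lcs W).

Lemma lcs_bounded_subset (A B : set W) :
  A `<=` B -> lcs_bounded Y B -> lcs_bounded Y A.
Proof.
move=> AB [BY bB]; split=> [|N /bB[r r0 Br]]; first exact: subset_trans BY.
by exists r => //; exact: subset_trans Br.
Qed.

Lemma lcs_bounded_image_ball (V : normedModType R) (S : {linear V -> W}) :
  (forall e, lcs_carrier Y (S e)) ->
  S e @[e --> (0 : V)] `=>` lcs_nbhs0 Y ->
  lcs_bounded Y (S @` [set e | `|e| <= 1]).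
Proof.
move=> SY S0; split=> [_ [e _ <-]//|N /S0/nbhs_ballP[r /= r0 rN]].
have r20 : 0 < r / 2 by rewrite divr_gt0.
exists (r / 2)^-1; first by rewrite invr_gt0.
move=> _ [e /= e1 <-]; exists (S ((r / 2) *: e)).
  apply: rN; rewrite -ball_normE /ball_ /= sub0r normrN normrZ gtr0_norm//.
  by rewrite (@le_lt_trans _ _ (r / 2))// ?ler_piMr ?(ltW r20)//; lra.
by rewrite linearZ scalerK ?gt_eqF.
Qed.

End lcs_bounded.

Section jets_of_linear_families.
Context {R : realType} {X F : normedModType R} (M : nat -> R) (K : set X).
Hypothesis wM : weight_sequence M.

Lemma CM_rho_cvg0 (V : normedModType R) (S : V -> jet X F K) rho c : 0 < rho ->
  (forall e k, continuous (S e k)) ->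
  (forall e, jet_bounded M rho (c * `|e|) (S e)) ->
  S e @[e --> (0 : V)] `=>` lcs_nbhs0 (CM_rho M K rho).
Proof.
move=> rho0 Sk Sc N [r r0 rN].
have d0 : 0 < `|c| + 1 by rewrite ltr_wpDl.
apply/nbhs_ballP; exists (r / (`|c| + 1)); first by rewrite /= divr_gt0.
move=> e; rewrite -ball_normE /ball_ /= sub0r normrN ltr_pdivlMr// => e_lt.
have /(jnorm_rho_leP wM _ rho0) Se : jet_bounded M rho (`|c| * `|e|) (S e).
  move=> m psi mpsi; rewrite (le_trans (Sc e m psi mpsi))//.
  by rewrite ler_pM2r ?jet_weight_gt0// ler_wpM2r// ler_norm.
have {}Se := Se (mulr_ge0 (normr_ge0 _) (normr_ge0 _)).
apply: rN; split; first by split; [exact: Sk|exact: le_lt_trans Se (ltry _)].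
apply: le_lt_trans Se _; rewrite lte_fin mulrC (le_lt_trans _ e_lt)//.
by rewrite ler_wpM2l// lerDl.
Qed.

Lemma jet_eventually_bounded_uniform (V : completeNormedModType R)
    (S : V -> jet X F K) (rho : nat -> R) : (forall n, 0 < rho n) ->
  (forall k x (v : 'I_k -> X), continuous_linear (fun e => S e k x v)) ->
  (forall e, exists c, \forall n \near \oo, jet_bounded M (rho n) c (S e)) ->
  exists n c, forall e, jet_bounded M (rho n) (c * `|e|) (S e).
Proof.
move=> rho0 Scl Sc; have w0 n m := jet_weight_gt0 wM m (rho0 n).
pose Phi n := [set f : V -> F | exists m psi, norming_map m psi /\
  f = fun e => (jet_weight M (rho n) m)^-1 *: psi (S e)].
have clc := @lincomb_closed_continuous_linear R V F.
have [||n [c Sn]] := @eventually_bounded_uniform _ _ _ Phi.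
- move=> n _ [m [psi [mpsi ->]]]; apply: lincomb_closedZ => //.
  exact: norming_map_lincomb mpsi.
- move=> e; have [c Se] := Sc e; exists c; apply: filterS Se => n Se.
  move=> _ [m [psi [mpsi ->]]].
  rewrite normrZ gtr0_norm ?invr_gt0// ler_pdivrMl// mulrC.
  exact: Se.
exists n, c => e m psi mpsi.
have := Sn _ (ex_intro _ m (ex_intro _ psi (conj mpsi erefl))) e.
by rewrite normrZ gtr0_norm ?invr_gt0// ler_pdivrMl// mulrC.
Qed.

Lemma CM_compact_cvg0 (V : completeNormedModType R) (S : V -> jet X F K)
    (b : flavour) :
  (forall k x (v : 'I_k -> X), continuous_linear (fun e => S e k x v)) ->
  (forall e, lcs_carrier (CM_compact M K b) (S e)) ->
  S e @[e --> (0 : V)] `=>` lcs_nbhs0 (CM_compact M K b).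
Proof.
move=> Scl; case: b => Sb.
  have Sk e k : continuous (S e k) by have [_ /(_ 1 ltr01)[]] := Sb e.
  apply: lcs_initial_cvg => rho rho0.
  have [//|e|_ [c Sc]] :=
      jet_eventually_bounded_uniform (rho := fun=> rho) _ Scl.
    have [_ /(_ rho rho0)/(CM_rho_carrierP wM _ rho0)[_ [c _ Sc]]] := Sb e.
    by exists c; exact: nearW.
  exact: CM_rho_cvg0 Sk Sc.
have Sk e k : continuous (S e k) by have [rho _ []] := Sb e.
have n0 n : 0 < n.+1%:R :> R by [].
have [e|n [c Sc]] := jet_eventually_bounded_uniform n0 Scl.
  have [rho rho0 /(CM_rho_carrierP wM _ rho0)[_ [c c0 Sc]]] := Sb e.
  exists c; near=> n; apply: (jet_bounded_le wM rho0 _ c0 Sc).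
  rewrite (le_trans (ltW (archi_boundP (ltW rho0))))// ler_nat leqW//.
  by near: n; exact: nbhs_infty_ge.
move=> N [A [_ _ AY AN]].
apply: filterS (CM_rho_cvg0 (n0 n) Sk Sc (AY _ (n0 n))).
by move=> e /AN.
Unshelve. all: by end_near. Qed.

End jets_of_linear_families.

(** * The uniform boundedness principle *)

Section CM_open.
Context {R : realType} {X F : normedModType R} (M : nat -> R) (U : set X).
Context (b : flavour).
Hypothesis wM : weight_sequence M.

Lemma CM_open_cvg0 (V : completeNormedModType R) (S : V -> U -> F) :
  radially_open U -> (forall e, lcs_carrier (CM_open M U b) (S e)) ->
  (forall x, continuous_linear (fun e => S e x)) ->
  S e @[e --> (0 : V)] `=>` lcs_nbhs0 (CM_open M U b).
Proof.
move=> oU SU Scl; apply: lcs_initial_cvg => K KU.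
apply: (CM_compact_cvg0 wM (S := fun e => jinf (K := K) (S e))) => [k x v|e].
  apply: frechet_jet_continuous_linear => // [e|]; first exact: (SU e).1.
  by have [_ _] := KU; apply; exact: set_mem (valP x).
exact: (SU e).2.
Qed.

Lemma CM_open_eval_nbhs0 (x : U) : exists2 N, lcs_nbhs0 (CM_open M U b) N &
  forall f : U -> F, lcs_carrier (CM_open M U b) f -> N f -> `|f x| <= 1.
Proof.
pose K := [set val x]; pose xK : K := exist _ (val x) (mem_set (erefl (val x))).
have KU : [/\ compact K, convex_set K & K `<=` U].
  split; [exact: compact_set1| |by move=> _ ->; exact: set_mem (valP x)].
  by move=> y z t /set_mem -> /set_mem ->; apply/mem_set; rewrite convmm.
pose v (i : 'I_0) : X := 0.
exists (@jinf _ _ _ U K @^-1` [set g : jet X F K | `|g 0 xK v| <= 1]).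
  apply: (@lcs_initial_nbhs0 _ _ _ _ _ _ _ (fun K => CM_compact M K b)) => //.
  exact: CM_compact_value_nbhs0.
move=> f [sf _].
by rewrite /= /jinf -[xget _ _]/(frechet_jet f) frechet_jet0.
Qed.

End CM_open.

Section CM.
Context {R : realType} {F G : convenientType R} (M : nat -> R) (b : flavour).
Context (U : set F).
Hypothesis wM : weight_sequence M.

Lemma radially_open_trace (D : bdisk F) :
  radially_open U -> radially_open (@trace _ _ U D).
Proof. by move=> oU x h; exact: oU. Qed.

Lemma CM_cvg0 (V : completeNormedModType R) (S : V -> U -> G) : cinfty_open U ->
  (forall e, lcs_carrier (CM G M b U) (S e)) ->
  (forall x (l : {linear G -> R^o}), continuous l ->
    continuous_linear (fun e => l (S e x))) ->
  S e @[e --> (0 : V)] `=>` lcs_nbhs0 (CM G M b U).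
Proof.
move=> /cinfty_open_radially_open oU SU Scl.
apply: lcs_initial_cvg => -[l D] /= lc; apply: CM_open_cvg0 => //.
- exact: radially_open_trace.
- by move=> e; exact: (SU e).2 (l, D) lc.
- by move=> x; exact: Scl.
Qed.

Lemma CM_eval_nbhs0 (x : U) (l : {linear G -> R^o}) : continuous l ->
  exists2 N, lcs_nbhs0 (CM G M b U) N &
    forall f, lcs_carrier (CM G M b U) f -> N f -> `|l (f x)| <= 1.
Proof.
move=> lc; pose D := hull_bdisk (bounded_set1 (val x)).
have xD : val x \in EB_pred D.
  by apply/mem_set => S [_]; apply; exact: sub_gen_smallest.
have xU : @trace _ _ U D (MkEB xD) by exact: set_mem (valP x).
pose xt : @trace _ _ U D := exist _ (MkEB xD) (mem_set xU).
have [N N0 Nf] := CM_open_eval_nbhs0 (F := R^o) b wM xt.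
exists ((fun f y => l (f (@trace_incl _ _ U D y)) : R^o) @^-1` N).
  exact: (@lcs_initial_nbhs0 _ _ _ _ _ _ _ _ (l, D)).
move=> f [_ fU] /(Nf _ (fU (l, D) lc)).
by have -> : trace_incl xt = x by exact/val_inj.
Qed.

End CM.

Section bounded_linear_map.
Context {R : realType} {E F G : convenientType R} (M : nat -> R) (b : flavour).
Context (U : set F) (T : {linear E -> (U -> G)}).
Hypothesis wM : weight_sequence M.
Hypothesis TU : forall e : E, lcs_carrier (CM G M b U) (T e).

Lemma bounded_map_pointwise (x : U) :
  bounded_map (lcs_of_tvs E) (CM G M b U) T ->
  bounded_map (lcs_of_tvs E) (lcs_of_tvs G) (fun e => T e x).
Proof.
move=> bT A /bT[_ bTA]; apply: weakly_bounded => l lc.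
have [N N0 Nl] := CM_eval_nbhs0 b wM x lc.
have [r r0 rN] := bTA N N0; exists r => _ [a Aa <-].
have [g Ng gE] := rN _ (imageP T Aa).
have Tg : T (r^-1 *: a) = g by rewrite linearZ /= -gE scalerK ?gt_eqF.
have : `|l (T (r^-1 *: a) x)| <= 1 by apply: Nl; [exact: TU|rewrite Tg].
have -> : T (r^-1 *: a) x = r^-1 *: T a x by rewrite linearZ.
by rewrite linearZ /= normrM gtr0_norm ?invr_gt0// ler_pdivrMl// mulr1.
Qed.

Lemma pointwise_bounded_map : cinfty_open U ->
  (forall x : U, bounded_map (lcs_of_tvs E) (lcs_of_tvs G) (fun e => T e x)) ->
  bounded_map (lcs_of_tvs E) (CM G M b U) T.
Proof.
move=> oU Tx A bA; pose B := hull_bdisk bA.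
pose S : {linear EB B -> (U -> G)} := T \o \val.
apply: (@lcs_bounded_subset _ _ _ _ (S @` [set e | `|e| <= 1])).
  move=> _ [a Aa <-]; have Ba : bdisk_set B (1^-1 *: a).
    by rewrite invr1 scale1r; exact: sub_gen_smallest.
  exists (MkEB (bdisk_EB_pred ltr01 Ba)) => //=.
  exact: EB_norm_le.
apply: lcs_bounded_image_ball; first by move=> e; exact: TU.
apply: CM_cvg0 => // [e|x l lc]; first exact: TU.
have fl : linear (fun e => l (T e x) : R^o).
  move=> a e e'; rewrite linearP.
  by rewrite -[(_ + _) x]/(a *: T e x + T e' x) linearP.
have [c Bc] := bounded_functional lc (Tx x _ (disk_hull_bounded bA)).
apply: (continuous_linear_EB_incl (f := pack_linear fl) (c := c)) => y By.
by apply: Bc; exists y.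
Qed.

End bounded_linear_map.

Theorem theorem6p1 (R : realType) (M : nat -> R) (wM : weight_sequence M)
    (b : flavour) (E F G : convenientType R) (U : set F) (oU : cinfty_open U)
    (T : {linear E -> (U -> G)})
    (TU : forall e : E, lcs_carrier (CM G M b U) (T e)) :
  bounded_map (lcs_of_tvs E) (CM G M b U) T <->
  forall x : U, bounded_map (lcs_of_tvs E) (lcs_of_tvs G) (fun e => T e x).
Proof.
split=> [bT x|]; first exact: (bounded_map_pointwise wM TU x bT).
exact: (pointwise_bounded_map wM TU oU).
Qed.
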